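(* The following three statements are equivalent. (1) $\mu$ satisfies a Poincaré inequality: there exists a constant $C_P<+\infty$ such that for all smooth $f$, $\mathrm{Var}_\mu(f)\le C_P\int \Gamma(f,f)\,d\mu$. (2) There exist some $1<p<+\infty$ and constants $\lambda_p>0$ and $K_p<+\infty$ such that for all $f\in L^p(\mu)$ and all $t\ge 0$, $$N_p(P_tf)\le K_p\,e^{-\lambda_p t}\,N_p(f).$$ (3) For all $1<p<+\infty$ there exist constants $\lambda_p>0$ and $K_p<+\infty$ such that for all $f\in L^p(\mu)$ and all $t\ge0$, $$N_p(P_tf)\le K_p\,e^{-\lambda_p t}\,N_p(f).$$
   Context: Setting. $(X_t)$ is a Markov process with infinitesimal generator $L$ and Polish state space $E$. The extended domain of $L$ contains a nice core $\mathcal D$ of uniformly continuous functions, which contains the constants and is an algebra; functions in $\mathcal D$ are called smooth. The carré du champ operator is $\Gamma(f,g)=\frac12\left(L(fg)-f\,Lg-g\,Lf\right)$, and the associated Dirichlet form is given for smooth $f$ by $\mathcal E(f,f)=-\int f\,Lf\,d\mu=\int\Gamma(f,f)\,d\mu$. The generator $L$ is $\mu$-symmetric for a probability measure $\mu$ on $E$, and generates a $\mu$-symmetric (hence stationary) semi-group $(P_t)_{t\ge0}$, which is a contraction semi-group on $L^p(\mu)$ for all $1\le p\le+\infty$, and for every $f\in L^2(\mu)$, $\|P_tf-\int f\,d\mu\|_{L^2(\mu)}\to0$ as $t\to+\infty$. The process is a diffusion: $\Gamma$ comes from a derivation, $\Gamma(fg,h)=f\,\Gamma(g,h)+g\,\Gamma(f,h)$,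 and the chain rule $L(\varphi(f))=\varphi'(f)\,Lf+\varphi''(f)\,\Gamma(f,f)$ holds for $\varphi$ of class $C^2$. Notation. $\|f\|_p^p=\int|f|^p\,d\mu$, $N_p(f)=\|f-\int f\,d\mu\|_p$, and $\mathrm{Var}_\mu(f)=\int f^2\,d\mu-\left(\int f\,d\mu\right)^2$. *)

(* Defs.v *)
From HB Require Import structures.
From mathcomp Require Import all_boot all_order all_algebra.
From mathcomp Require Import all_classical all_reals all_analysis.

Set Implicit Arguments.
Unset Strict Implicit.
Unset Printing Implicit Defensive.

Import Order.TTheory GRing.Theory Num.Theory.
Import numFieldNormedType.Exports.

Local Open Scope classical_set_scope.
Local Open Scope ring_scope.

Notation borel E := (g_sigma_algebraType (@open E)).

(* Together with the completeness that is part of [completePseudoMetricType],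
   this says that E is Polish; the uniform structure of E fixes which functions
   are uniformly continuous. *)
Definition polish (R : realType) (E : completePseudoMetricType R) : Prop :=
  hausdorff_space E /\ @second_countable E.

Definition class_C2 (R : realType) (phi : R -> R) : Prop :=
  [/\ forall x, derivable phi x 1,
      forall x, derivable (derive1 phi) x 1 &
      continuous (derive1n 2 phi)].

Section Martingales.
Context (R : realType) (d : measure_display) (Omega : measurableType d).

(* Processes and filtrations are indexed by R, and only their values at times
   t >= 0 are meaningful. *)
Definition filtration (F : R -> set (set Omega)) : Prop :=
  [/\ forall t, 0 <= t -> sigma_algebra [set: Omega] (F t),
      forall t, 0 <= t -> F t `<=` measurable &
      forall s t, 0 <= s -> s <= t -> F s `<=` F t].

Definition adapted (F : R -> set (set Omega)) d' (T : measurableType d')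
    (X : R -> Omega -> T) : Prop :=
  forall t, 0 <= t -> forall B : set T, measurable B -> F t (X t @^-1` B).

Definition martingale (F : R -> set (set Omega)) (Q : probability Omega R)
    (M : R -> Omega -> R) : Prop :=
  [/\ adapted F M,
      forall t, 0 <= t -> Q.-integrable setT (EFin \o M t) &
      forall s t, 0 <= s -> s <= t -> forall A, F s A ->
        \int[Q]_(w in A) M t w = \int[Q]_(w in A) M s w].

Definition stopping_time (F : R -> set (set Omega)) (tau : Omega -> \bar R) :
    Prop :=
  (forall w, (0 <= tau w)%E) /\
  (forall t, 0 <= t -> F t [set w | (tau w <= t%:E)%E]).

Definition stopped (M : R -> Omega -> R) (tau : Omega -> \bar R) :
    R -> Omega -> R :=
  fun t w => M (fine (Order.min t%:E (tau w))) w.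

Definition local_martingale (F : R -> set (set Omega)) (Q : probability Omega R)
    (M : R -> Omega -> R) : Prop :=
  [/\ adapted F M,
      {ae Q, forall w, forall t, 0 <= t -> M u w @[u --> t^'+] --> M t w} &
      exists tau : nat -> Omega -> \bar R,
        [/\ forall n, stopping_time F (tau n),
            {ae Q, forall w, nondecreasing_seq (tau^~ w)},
            {ae Q, forall w, tau n w @[n --> \oo] --> +oo%E} &
            forall n, martingale F Q (stopped M (tau n))]].

End Martingales.

Section MarkovProcess.
Context (R : realType) (E : completePseudoMetricType R).
Context (d : measure_display) (Omega : measurableType d).

Definition transition_function (P : R -> R.-pker borel E ~> borel E) : Prop :=
  (forall x (B : set (borel E)), measurable B -> P 0 x B = \d_x B) /\
  (forall s t, 0 <= s -> 0 <= t -> forall x (B : set (borel E)), measurable B ->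
     P (s + t) x B = (\int[P s x]_y P t y B)%E).

(* [Q x] is the law of the process started at x. *)
Definition markov_process (F : R -> set (set Omega)) (X : R -> Omega -> borel E)
    (Q : E -> probability Omega R) (P : R -> R.-pker borel E ~> borel E) :
    Prop :=
  [/\ filtration F,
      adapted F X,
      transition_function P,
      forall x, {ae Q x, forall w, X 0 w = x} &
      forall x s t, 0 <= s -> 0 <= t ->
        forall A, F s A -> forall B : set (borel E), measurable B ->
          Q x (A `&` X (s + t) @^-1` B) =
          (\int[Q x]_(w in A) P t (X s w) B)%E].

(* The extended generator: f is in the extended domain, with image g, when
   f(X_t) - f(X_0) - \int_0^t g(X_s) ds is a local martingale under every
   starting law. The function g is determined up to a set of zero potential,
   which in particular is negligible for any invariant probability. *)
Definition extended_generator (F : R -> set (set Omega))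
    (X : R -> Omega -> borel E) (Q : E -> probability Omega R)
    (f g : borel E -> R) : Prop :=
  [/\ measurable_fun setT f,
      measurable_fun setT g &
      forall x,
        {ae Q x, forall w, forall t, 0 <= t ->
          lebesgue_measure.-integrable `[0, t] (fun s => (g (X s w))%:E)} /\
        local_martingale F (Q x)
          (fun t w => f (X t w) - f (X 0 w)
             - \int[lebesgue_measure]_(s in `[0, t]) g (X s w))].

Definition extended_domain (F : R -> set (set Omega))
    (X : R -> Omega -> borel E) (Q : E -> probability Omega R) :
    set (borel E -> R) :=
  [set f | exists g, extended_generator F X Q f g].

End MarkovProcess.

Section Semigroup.
Context (R : realType) (E : completePseudoMetricType R).
Implicit Types (P : R -> R.-pker borel E ~> borel E).
Implicit Types (mu : probability (borel E) R) (f g h : borel E -> R).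

Definition semigroup P (t : R) f : borel E -> R :=
  fun x => \int[P t x]_y f y.

Definition Lp_norm mu (p : \bar R) f : \bar R := 'N[mu]_p[EFin \o f]%E.

Definition L2_generator P mu f g : Prop :=
  [/\ f \in Lfun mu 2%:E, g \in Lfun mu 2%:E &
      Lp_norm mu 2%:E (fun x => t^-1 * (semigroup P t f x - f x) - g x)
        @[t --> 0^'+] --> 0%E].

(* [D] is a core of the L^2(mu)-generator of P, on which this generator is [L]:
   D is dense in L^2(mu), and the graph of L over D is contained, and dense, in
   that of the generator. *)
Definition L2_core P mu (D : set (borel E -> R))
    (L : (borel E -> R) -> borel E -> R) : Prop :=
  [/\ forall f, D f -> L2_generator P mu f (L f),
      forall f, f \in Lfun mu 2%:E -> forall e : R, 0 < e ->
        exists h, D h /\ (Lp_norm mu 2%:E (f \- h)%R < e%:E)%E &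
      forall f g, L2_generator P mu f g -> forall e : R, 0 < e ->
        exists h, [/\ D h,
          (Lp_norm mu 2%:E (f \- h)%R < e%:E)%E &
          (Lp_norm mu 2%:E (g \- L h)%R < e%:E)%E]].

Definition carre_du_champ (L : (borel E -> R) -> borel E -> R) f g :
    borel E -> R :=
  fun x => 2^-1 * (L (f \* g) x - f x * L g x - g x * L f x).

Definition function_algebra (D : set (borel E -> R)) : Prop :=
  [/\ forall c : R, D (cst c),
      forall (a : R) f g, D f -> D g -> D (a \*o f \+ g) &
      forall f g, D f -> D g -> D (f \* g)].

Definition centered_norm mu (p : R) f : \bar R :=
  Lp_norm mu p%:E (fun x => f x - \int[mu]_y f y).

Definition variance_of mu f : R :=
  \int[mu]_x (f x ^+ 2) - (\int[mu]_x f x) ^+ 2.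

Definition poincare mu (D : set (borel E -> R))
    (L : (borel E -> R) -> borel E -> R) : Prop :=
  exists C : R, forall f, D f ->
    variance_of mu f <= C * \int[mu]_x carre_du_champ L f f x.

Definition exponential_decay P mu (p : R) : Prop :=
  exists lambda K : R, 0 < lambda /\
    forall f, f \in Lfun mu p%:E -> forall t, 0 <= t ->
      (centered_norm mu p (semigroup P t f)
         <= (K * expR (- lambda * t))%:E * centered_norm mu p f)%E.

End Semigroup.

(* L f is only determined up to negligible sets, so the pointwise identities
   satisfied by L hold mu-almost everywhere. *)
Record symmetric_diffusion (R : realType) (E : completePseudoMetricType R)
    (d : measure_display) (Omega : measurableType d)
    (F : R -> set (set Omega)) (X : R -> Omega -> borel E)
    (Q : E -> probability Omega R) (P : R -> R.-pker borel E ~> borel E)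
    (L : (borel E -> R) -> borel E -> R) (D : set (borel E -> R))
    (mu : probability (borel E) R) : Prop := {
  sd_polish : polish E ;
  sd_markov : markov_process F X Q P ;
  sd_generator : forall f, extended_domain F X Q f ->
    extended_generator F X Q f (L f) ;
  sd_domain : D `<=` extended_domain F X Q ;
  sd_unif_continuous : forall f, D f -> unif_continuous (f : E -> R) ;
  sd_algebra : function_algebra D ;
  sd_core : L2_core P mu D L ;
  sd_symmetric_generator : forall f g, D f -> D g ->
    \int[mu]_x (f x * L g x) = \int[mu]_x (g x * L f x) ;
  sd_dirichlet_form : forall f, D f ->
    \int[mu]_x carre_du_champ L f f x = - \int[mu]_x (f x * L f x) ;
  sd_symmetric : forall f g, f \in Lfun mu 2%:E -> g \in Lfun mu 2%:E ->
    forall t, 0 <= t ->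
    \int[mu]_x (f x * semigroup P t g x) = \int[mu]_x (g x * semigroup P t f x) ;
  sd_contraction : forall p : \bar R, (1 <= p)%E ->
    forall f, f \in Lfun mu p -> forall t, 0 <= t ->
    (Lp_norm mu p (semigroup P t f) <= Lp_norm mu p f)%E ;
  sd_strongly_continuous : forall f, f \in Lfun mu 2%:E ->
    Lp_norm mu 2%:E (semigroup P t f \- f) @[t --> 0^'+] --> 0%E ;
  sd_ergodic : forall f, f \in Lfun mu 2%:E ->
    Lp_norm mu 2%:E (fun x => semigroup P t f x - \int[mu]_y f y)
      @[t --> +oo] --> 0%E ;
  sd_derivation : forall f g h, D f -> D g -> D h ->
    {ae mu, forall x, carre_du_champ L (f \* g) h x =
      f x * carre_du_champ L g h x + g x * carre_du_champ L f h x} ;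
  sd_chain_rule : forall f (phi : R -> R), D f -> class_C2 phi ->
    extended_domain F X Q (phi \o f) /\
    {ae mu, forall x, L (phi \o f) x =
      derive1 phi (f x) * L f x + derive1n 2 phi (f x) * carre_du_champ L f f x} }.

(* Main.v *)
From HB Require Import structures.
Require Import Defs.
From mathcomp Require Import all_boot all_order all_algebra.
From mathcomp Require Import all_classical all_reals all_analysis.
From mathcomp Require Import measurable_realfun ring lra.

Set Implicit Arguments.
Unset Strict Implicit.
Unset Printing Implicit Defensive.

Import Order.TTheory GRing.Theory Num.Theory.
Import numFieldNormedType.Exports.

Local Open Scope classical_set_scope.
Local Open Scope ring_scope.

(** The three statements are linked by the exponential decay of the L^p norms of
    P_t on bounded centred functions, called [bounded_decay] below.

    Passage between exponents. No interpolation theorem is used: since the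
    semigroup is given by Markov kernels, Jensen's inequality
    |P_s u|^a <= P_s |u|^a holds pointwise. Applied to u = P_s f it turns a decay
    in L^q into a decay in L^(a q) for 1 <= a <= q: writing g = |u|^a, the centred
    part of g is contracted by P_s, and the mean of g is a power of an L^a norm
    of P_s f, which has already decayed ([bounded_decay_up]). Iterating reaches
    every exponent above q > 1 ([bounded_decay_ge]). The symmetry of P_t gives
    the decay in the conjugate exponent ([bounded_decay_dual]). One of two
    conjugate exponents is at most 2, so the decay for one exponent implies the
    decay in L^2, hence in L^p for p >= 2, hence, by duality again, for all p > 1
    ([bounded_decay_all]). The restriction to bounded functions is removed by
    density and contraction ([bounded_decay_Lp]).

    Poincare inequality and decay in L^2. For f in L^2, the function
    t |-> <f, P_t f> is convex, its second differences being squared norms of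
    differences P_a f - P_b f, and its slope at 0 is <f, L f> = - E(f, f). Since
    Var P_t f and <f, P_(2 t) f> differ by a constant, comparing the slope at 0
    with a mean slope gives Var f - Var P_(t/2) f <= t E(f, f)
    ([dissipation_le]), and comparing the slope at time t with a mean slope gives
    t E(P_(t/2) f, P_(t/2) f) <= Var f - Var P_(t/2) f ([dissipation_ge]). If the
    variance decays, taking t large in the former makes the left-hand side at
    least half of Var f, which is a Poincare inequality ([L2_decay_poincare]).
    Conversely, a Poincare inequality on the core extends to the domain of the
    generator ([poincare_generator]), and then the latter bound shows that P_(1/2)
    contracts the standard deviation by a constant factor
    ([poincare_contraction]), which the semigroup property turns into an
    exponential decay ([poincare_L2_decay]). *)

(** * Integration against a probability kernel *)

(** The Markov operator of a kernel: [semigroup P t] is [kernel_op (P t)]. At a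
    point x where f is not integrable under k x the value is meaningless, so the
    identities about unbounded functions hold almost everywhere only. *)
Definition kernel_op (R : realType) d (T : measurableType d)
    (k : R.-pker T ~> T) (f : T -> R) : T -> R :=
  fun x => \int[k x]_y f y.

(** [n] is the image of [m] under the kernel [k]. *)
Definition kernel_image (R : realType) d (T : measurableType d)
    (k : R.-pker T ~> T) (m n : {measure set T -> \bar R}) : Prop :=
  forall B, measurable B -> n B = (\int[m]_x k x B)%E.

Section KernelImage.
Context (R : realType) d (T : measurableType d) (k : R.-pker T ~> T).
Context (m n : {measure set T -> \bar R}).
Hypothesis mn : kernel_image k m n.

Import HBNNSimple.

(** The disintegration formula extends from indicators to nonnegative functions
    by linearity and monotone convergence. *)
Lemma integral_kernel_image (f : T -> \bar R) :
  measurable_fun setT f -> (forall x, 0 <= f x)%E ->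
  (\int[n]_x f x = \int[m]_x \int[k x]_y f y)%E.
Proof.
move=> mf f0; pose g := nnsfun_approx measurableT mf.
have mgE i : measurable_fun [set: T] (EFin \o g i) by exact/measurable_EFinP.
have gE_ge0 i x : (0 <= (EFin \o g i) x)%E by rewrite lee_fin.
have nd_gE x : {homo (fun i => (EFin \o g i) x) : a b / (a <= b)%O >-> (a <= b)%E}.
  by move=> a b ab; rewrite lee_fin; exact/lefP/nd_nnsfun_approx.
have mk i : measurable_fun setT (fun x => \int[k x]_y (EFin \o g i) y)%E.
  by apply: measurable_fun_integral_kernel => // U mU; exact: measurable_kernel.
have simple i :
    (\int[n]_x (EFin \o g i) x = \int[m]_x \int[k x]_y (EFin \o g i) y)%E.
  rewrite integralT_nnsfun sintegralE.
  under [RHS]eq_integral do rewrite integralT_nnsfun sintegralE.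
  rewrite ge0_integral_fsum//; last 2 first.
    move=> r; apply: measurable_funeM.
    by apply: measurable_kernel; exact: measurable_sfunP.
  - by move=> r x _; exact: nnsfun_mulemu_ge0.
  apply: eq_fsbigr => r _.
  have mr : measurable (g i @^-1` [set r]) by exact: measurable_sfunP.
  have [r0|r0] := leP 0 r.
    by rewrite ge0_integralZl// ?mn//; exact: measurable_kernel.
  rewrite preimage_nnfun0// measure0 mule0.
  by under eq_integral do rewrite measure0 mule0; rewrite integral0.
transitivity (limn (fun i => \int[n]_x (EFin \o g i) x))%E.
  rewrite -monotone_convergence//; apply: eq_integral => t _.
  by apply/esym/cvg_lim => //; exact: cvg_nnsfun_approx.
under eq_fun do rewrite simple.
rewrite -monotone_convergence//; last 2 first.
- by move=> i x _; exact: integral_ge0.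
- by move=> x _ a b ab; apply: ge0_le_integral => // t _; exact: nd_gE.
apply: eq_integral => x _; rewrite -monotone_convergence//.
by apply: eq_integral => t _; apply/cvg_lim => //; exact: cvg_nnsfun_approx.
Qed.

End KernelImage.

Section KernelOp.
Context (R : realType) d (T : measurableType d) (k : R.-pker T ~> T).
Implicit Types (f g : T -> R) (nu : {measure set T -> \bar R}).

Lemma integrable_bounded nu f (M : R) : nu setT = 1%E ->
  measurable_fun setT f -> (forall x, `|f x| <= M) ->
  nu.-integrable setT (EFin \o f).
Proof.
move=> nu1 mf fM; apply: measurable_bounded_integrable => //.
  by rewrite nu1 ltry.
by exists M; split; [exact: num_real|move=> y My x _; exact: le_trans (ltW My)].
Qed.

Lemma measurable_integral_kernel f : measurable_fun setT f ->
  measurable_fun setT (fun x => \int[k x]_y (f y)%:E)%E.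
Proof.
move=> mf; have mF : measurable_fun setT (EFin \o f) by exact/measurable_EFinP.
under eq_fun do rewrite integralE.
apply: emeasurable_funB.
  apply: measurable_fun_integral_kernel => //.
    by move=> U mU; exact: measurable_kernel.
  exact: measurable_funepos.
apply: measurable_fun_integral_kernel => //.
  by move=> U mU; exact: measurable_kernel.
exact: measurable_funeneg.
Qed.

Lemma measurable_kernel_op f : measurable_fun setT f ->
  measurable_fun setT (kernel_op k f).
Proof.
move=> mf; apply: measurableT_comp (measurable_integral_kernel mf).
exact: fine_measurable.
Qed.

Lemma kernel_op_cst (c : R) : kernel_op k (cst c) = cst c.
Proof.
by apply/funext => x; rewrite /kernel_op Rintegral_cst// prob_kernel /= mulr1.
Qed.

Lemma kernel_op_bounded f (M : R) : measurable_fun setT f ->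
  (forall x, `|f x| <= M) -> forall x, `|kernel_op k f x| <= M.
Proof.
move=> mf fM x; have k1 : k x setT = 1%E by exact: prob_kernel.
have fi := integrable_bounded k1 mf fM.
apply: (le_trans (le_normr_Rintegral _ _)) => //.
have -> : M = \int[k x]_y M by rewrite Rintegral_cst// prob_kernel /= mulr1.
apply: le_Rintegral => //.
- exact: integrable_norm.
- by apply: (@integrable_bounded _ _ `|M|).
Qed.

Lemma kernel_opB_at x f g :
  (k x).-integrable setT (EFin \o f) -> (k x).-integrable setT (EFin \o g) ->
  kernel_op k (f \- g) x = kernel_op k f x - kernel_op k g x.
Proof. by move=> fi gi; rewrite /kernel_op RintegralB. Qed.

Lemma kernel_opZ_at x (a : R) f : (k x).-integrable setT (EFin \o f) ->
  kernel_op k (fun y => a * f y) x = a * kernel_op k f x.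
Proof. by move=> fi; rewrite /kernel_op RintegralZl. Qed.

Section Image.
Context (m n : {measure set T -> \bar R}).
Hypothesis mn : kernel_image k m n.

(** An integrable function is integrable under almost every k x, because the
    integrals of its absolute value are. *)
Lemma ae_integrable_kernel f : n.-integrable setT (EFin \o f) ->
  {ae m, forall x, (k x).-integrable setT (EFin \o f)}.
Proof.
move=> /integrableP[mf fi].
have maf : measurable_fun setT (fun x => `|(EFin \o f) x|)%E.
  exact: measurableT_comp.
have : m.-integrable setT (fun x => \int[k x]_y `|(EFin \o f) y|)%E.
  apply/integrableP; split.
    apply: measurable_fun_integral_kernel => // U mU; exact: measurable_kernel.
  under eq_integral do rewrite gee0_abs ?integral_ge0//.
  by rewrite -(integral_kernel_image mn).
move=> /(integrable_ae measurableT); apply: filterS => x /(_ I) xfin.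
by apply/integrableP; split => //; rewrite ltey_eq xfin.
Qed.

Lemma Rintegral_kernel_op f : n.-integrable setT (EFin \o f) ->
  \int[m]_x kernel_op k f x = \int[n]_x f x.
Proof.
move=> /[dup] fi /integrableP[mf fy].
have mf' : measurable_fun setT f by exact/measurable_EFinP.
congr fine; rewrite (integralE n).
have mfp := measurable_funepos mf; have mfn := measurable_funeneg mf.
rewrite !(integral_kernel_image mn)//.
have mk (h : T -> \bar R) : measurable_fun setT h -> (forall x, 0 <= h x)%E ->
    measurable_fun setT (fun x => \int[k x]_y h y)%E.
  by move=> mh h0; apply: measurable_fun_integral_kernel => // U mU;
    exact: measurable_kernel.
have ik (h : T -> \bar R) : measurable_fun setT h -> (forall x, 0 <= h x)%E ->
    (\int[n]_x h x < +oo)%E -> m.-integrable setT (fun x => \int[k x]_y h y)%E.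
  move=> mh h0 hy; apply/integrableP; split; first exact: mk.
  under eq_integral do rewrite gee0_abs ?integral_ge0//.
  by rewrite -(integral_kernel_image mn).
have ip := ik _ mfp (fun=> funepos_ge0 _ _) (integral_funepos_lt_pinfty measurableT fi).
have im := ik _ mfn (fun=> funeneg_ge0 _ _) (integral_funeneg_lt_pinfty measurableT fi).
rewrite -integralB//; apply: ae_eq_integral => //.
- exact/measurable_EFinP/measurable_kernel_op.
- by apply: emeasurable_funB; exact: mk.
- apply: filterS (ae_integrable_kernel fi) => x xf _ /=.
  rewrite /kernel_op /Rintegral fineK ?integrable_fin_num//.
  by rewrite integralE.
Qed.

End Image.
End KernelOp.

(** Chapman-Kolmogorov for operators: if the kernel [l] is [k1] followed by [k2],
    then the operator of [l] is the composite one, at each point where the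
    function is integrable. *)
Lemma kernel_op_comp (R : realType) d (T : measurableType d)
    (k1 k2 l : R.-pker T ~> T) (f : T -> R) x :
  kernel_image k2 (k1 x) (l x) -> (l x).-integrable setT (EFin \o f) ->
  kernel_op l f x = kernel_op k1 (kernel_op k2 f) x.
Proof. by move=> kl fi; rewrite {2}/kernel_op (Rintegral_kernel_op kl). Qed.

(** * Real-valued Lebesgue norms *)

(** The L^r norm as a real number; it is meaningful on [Lfun mu r%:E], an
    infinite norm being read as 0. *)
Definition rnorm (R : realType) d (T : measurableType d)
    (mu : {measure set T -> \bar R}) (r : R) (f : T -> R) : R :=
  fine ('N[mu]_r%:E[EFin \o f])%E.

Lemma ler_powRl (R : realType) (r x y : R) : 0 < r -> 0 <= x -> 0 <= y ->
  (x `^ r <= y `^ r) = (x <= y).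
Proof.
move=> r0 x0 y0; apply/idP/idP => [|xy]; last exact: ge0_ler_powR (ltW r0) _ _ _ _ xy.
by apply: contraTT; rewrite -!ltNge => yx; exact: gt0_ltr_powR.
Qed.

Section RealNorm.
Context (R : realType) d (T : measurableType d).
Context (mu : {measure set T -> \bar R}).
Implicit Types (f g : T -> R) (p q r s a : R).

Lemma LfunE r f : f \in Lfun mu r%:E <->
  measurable_fun setT f /\ ('N[mu]_r%:E[EFin \o f] < +oo)%E.
Proof.
rewrite inE; split=> [/andP[]|[mf ff]]; first by rewrite !inE.
by apply/andP; rewrite !inE.
Qed.

Lemma Lfun_measurable r f : f \in Lfun mu r%:E -> measurable_fun setT f.
Proof. by move=> /LfunE[]. Qed.

Lemma rnorm_ge0 r f : 0 <= rnorm mu r f.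
Proof. exact: fine_ge0 (Lnorm_ge0 _ _ _). Qed.

Lemma EFin_rnorm r f : f \in Lfun mu r%:E ->
  (rnorm mu r f)%:E = 'N[mu]_r%:E[EFin \o f]%E.
Proof. by move=> /LfunE[_ ff]; rewrite fineK// ge0_fin_numE// Lnorm_ge0. Qed.

Lemma LfunD r f g : 1 <= r -> f \in Lfun mu r%:E -> g \in Lfun mu r%:E ->
  f \+ g \in Lfun mu r%:E.
Proof.
move=> r1 /LfunE[mf ff] /LfunE[mg fg]; apply/LfunE; split.
  exact: measurable_funD.
by apply: le_lt_trans (minkowski_EFin mu mf mg r1) _; rewrite lte_add_pinfty.
Qed.

Lemma LfunZ r c f : 1 <= r -> f \in Lfun mu r%:E ->
  (fun x => c * f x) \in Lfun mu r%:E.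
Proof.
move=> r1 lf; rewrite (_ : (fun _ => _) = c \o* f); last first.
  by apply/funext => x /=; rewrite mulrC.
exact: Lfun_scale.
Qed.

Lemma LfunB r f g : 1 <= r -> f \in Lfun mu r%:E -> g \in Lfun mu r%:E ->
  f \- g \in Lfun mu r%:E.
Proof.
move=> r1 lf lg; rewrite (_ : f \- g = f \+ (fun x => -1 * g x)); last first.
  by apply/funext => x /=; rewrite mulN1r.
by apply: LfunD => //; exact: LfunZ.
Qed.

Lemma rnormD r f g : 1 <= r -> f \in Lfun mu r%:E -> g \in Lfun mu r%:E ->
  rnorm mu r (f \+ g) <= rnorm mu r f + rnorm mu r g.
Proof.
move=> r1 lf lg; rewrite -lee_fin EFinD !EFin_rnorm//; last exact: LfunD.
by apply: minkowski_EFin => //; [exact: Lfun_measurable lf|exact: Lfun_measurable lg].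
Qed.

Lemma rnormN r f : rnorm mu r (fun x => - f x) = rnorm mu r f.
Proof. by rewrite /rnorm -[in RHS]oppe_Lnorm. Qed.

Lemma eq_rnorm r f g : f =1 g -> rnorm mu r f = rnorm mu r g.
Proof. by move=> fg; congr rnorm; apply/funext. Qed.

Lemma rnorm_normr r f : rnorm mu r (fun x => `|f x|) = rnorm mu r f.
Proof. by rewrite /rnorm -[in RHS]Lnorm_abse. Qed.

Lemma rnormB r f g : 1 <= r -> f \in Lfun mu r%:E -> g \in Lfun mu r%:E ->
  rnorm mu r (f \- g) <= rnorm mu r f + rnorm mu r g.
Proof.
move=> r1 lf lg; rewrite -(rnormN r g); apply: rnormD => //.
rewrite (_ : (fun _ => _) = (fun x => -1 * g x)); first exact: LfunZ.
by apply/funext => x; rewrite mulN1r.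
Qed.

(** The reverse triangle inequality, in additive form. *)
Lemma rnorm_sub r f g : 1 <= r -> f \in Lfun mu r%:E -> g \in Lfun mu r%:E ->
  rnorm mu r f <= rnorm mu r g + rnorm mu r (f \- g).
Proof.
move=> r1 lf lg; rewrite (@eq_rnorm _ f (g \+ (f \- g))).
  by apply: rnormD => //; exact: LfunB.
by move=> x /=; rewrite subrKC.
Qed.

Lemma rnormBC r f g : rnorm mu r (f \- g) = rnorm mu r (g \- f).
Proof.
by rewrite -rnormN; apply: eq_rnorm => x /=; rewrite opprB.
Qed.

Lemma rnorm_powR r f : 0 < r -> rnorm mu r f `^ r = \int[mu]_x (`|f x| `^ r).
Proof.
move=> r0; rewrite /rnorm /Rintegral.
by rewrite -fine_poweR poweR_Lnorm ?gt_eqF.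
Qed.

Lemma rnormE r f : 0 < r -> rnorm mu r f = (\int[mu]_x (`|f x| `^ r)) `^ r^-1.
Proof.
by move=> r0; rewrite -rnorm_powR// -powRrM divff ?gt_eqF// powRr1// rnorm_ge0.
Qed.

Lemma rnorm1 f : rnorm mu 1 f = \int[mu]_x `|f x|.
Proof. by rewrite /rnorm Lnorm1. Qed.

Lemma rnorm_comp_powR q a f : 0 < q -> 0 < a ->
  rnorm mu q (fun x => `|f x| `^ a) = rnorm mu (a * q) f `^ a.
Proof.
move=> q0 a0; rewrite rnormE// rnormE ?mulr_gt0// -powRrM.
have -> : (a * q)^-1 * a = q^-1.
  by rewrite invfM -mulrA (mulrC q^-1) mulrA mulVf ?mul1r// gt_eqF.
have -> // : \int[mu]_x (`| `|f x| `^ a| `^ q) = \int[mu]_x (`|f x| `^ (a * q)).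
by apply: eq_Rintegral => x _; rewrite (ger0_norm (powR_ge0 _ a)) -powRrM.
Qed.

Lemma ae_eq_rnorm r f g : 0 < r -> measurable_fun setT f ->
  measurable_fun setT g -> {ae mu, forall x, f x = g x} ->
  rnorm mu r f = rnorm mu r g.
Proof.
move=> r0 mf mg fg.
have mpow (h : T -> R) : measurable_fun setT h ->
    measurable_fun setT (fun x => (`|h x| `^ r)%:E).
  move=> mh; apply/measurable_EFinP.
  by apply: (measurableT_comp (measurable_powR _)); exact: measurableT_comp.
have fgE : \int[mu]_x (`|f x| `^ r) = \int[mu]_x (`|g x| `^ r).
  rewrite /Rintegral; have -> // :
      (\int[mu]_x (`|f x| `^ r)%:E = \int[mu]_x (`|g x| `^ r)%:E)%E.
  apply: ae_eq_integral => //; [exact: mpow|exact: mpow|].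
  by apply: filterS fg => x -> _.
by rewrite (rnormE f r0) (rnormE g r0) fgE.
Qed.

Lemma rnorm_hoelder p q f g : 0 < p -> 0 < q -> p^-1 + q^-1 = 1 ->
  f \in Lfun mu p%:E -> g \in Lfun mu q%:E ->
  f \* g \in Lfun mu 1 /\
  `|\int[mu]_x (f x * g x)| <= rnorm mu p f * rnorm mu q g.
Proof.
move=> p0 q0 pq lf lg.
have mf := Lfun_measurable lf; have mg := Lfun_measurable lg.
have le := hoelder mu mf mg p0 q0 pq.
have lfg : f \* g \in Lfun mu 1.
  apply/LfunE; split; first exact: measurable_funM.
  apply: le_lt_trans le _; rewrite -EFin_rnorm// -EFin_rnorm//.
  by rewrite -EFinM ltry.
split => //; have /Lfun1_integrable ifg := lfg.
have := le_normr_Rintegral measurableT ifg; move=> /le_trans; apply.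
rewrite -lee_fin EFinM !EFin_rnorm//; apply: le_trans le.
rewrite Lnorm1 /Rintegral fineK//.
by apply: integrable_fin_num => //; exact: integrable_norm.
Qed.

Section MassOne.
Hypothesis mu1 : mu setT = 1%E.

Lemma mean_cst c : \int[mu]_x c = c.
Proof. by rewrite Rintegral_cst// mu1 mulr1. Qed.

Lemma rnorm_cst r c : 0 < r -> rnorm mu r (cst c) = `|c|.
Proof.
move=> r0; rewrite rnormE//= Rintegral_cst// mu1 mulr1 -powRrM divff ?gt_eqF//.
by rewrite powRr1.
Qed.

Lemma Lfun_bounded r f M : 0 < r -> measurable_fun setT f ->
  (forall x, `|f x| <= M) -> f \in Lfun mu r%:E.
Proof.
move=> r0 mf fM; apply/LfunE; split => //; rewrite unlock poweR_lty//.
have -> : (\int[mu]_x (`|(EFin \o f) x| `^ r) =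
    \int[mu]_x `|(`|f x| `^ r)%:E|)%E.
  by apply: eq_integral => x _ /=; rewrite (ger0_norm (powR_ge0 _ r)).
suff : mu.-integrable setT (EFin \o (fun x => `|f x| `^ r)).
  by move=> /integrableP[].
apply: (@integrable_bounded _ _ _ _ _ (M `^ r)) => //.
  by apply: (measurableT_comp (measurable_powR _)); exact: measurableT_comp.
move=> x; rewrite ger0_norm ?powR_ge0//.
have M0 : 0 <= M := le_trans (normr_ge0 _) (fM x).
by apply: ge0_ler_powR => //; exact: ltW.
Qed.

Lemma Lfun_le r s f : 1 <= r -> r <= s -> f \in Lfun mu s%:E ->
  f \in Lfun mu r%:E.
Proof.
move=> r1 rs; apply: Lfun_subset; rewrite ?lee_fin ?mu1//.
exact: le_trans r1 rs.
Qed.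

Lemma Lfun_int r f : 1 <= r -> f \in Lfun mu r%:E ->
  mu.-integrable setT (EFin \o f).
Proof. by move=> r1 lf; apply/Lfun1_integrable; exact: Lfun_le lf. Qed.

Lemma Lfun_cst1 r c : 0 < r -> cst c \in Lfun mu r%:E.
Proof.
by move=> r0; apply: (@Lfun_bounded _ _ `|c|) => //.
Qed.

(** The norms of a probability measure increase with the exponent: Hoelder's
    inequality for |f|^r and 1. *)
Lemma rnorm_le r s f : 1 <= r -> r <= s -> f \in Lfun mu s%:E ->
  rnorm mu r f <= rnorm mu s f.
Proof.
move=> r1; have r0 : 0 < r by exact: lt_le_trans r1.
rewrite le_eqVlt => /predU1P[<-//|rs lf].
have s0 : 0 < s by exact: lt_trans rs.
pose p := s / r; pose q := (1 - p^-1)^-1.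
have p1 : 1 < p by rewrite ltr_pdivlMr// mul1r.
have p0 : 0 < p by exact: lt_trans p1.
have pV : p^-1 < 1 by rewrite invf_lt1.
have q0 : 0 < q by rewrite invr_gt0 subr_gt0.
have pq : p^-1 + q^-1 = 1 by rewrite invrK subrKC.
have mf := Lfun_measurable lf.
have rp : r * p = s by rewrite mulrC divfK ?gt_eqF.
have lfr : (fun x => `|f x| `^ r) \in Lfun mu p%:E.
  apply/LfunE; split.
    by apply: (measurableT_comp (measurable_powR _)); exact: measurableT_comp.
  rewrite unlock poweR_lty//.
  have := Lfun_integrable (le_trans r1 (ltW rs)) lf.
  move=> /integrableP[_]; apply: le_lt_trans.
  apply: ge0_le_integral => //.
  - by move=> x _; exact: poweR_ge0.
  - apply: (measurableT_comp (measurable_poweR _)) => //.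
    apply: measurableT_comp => //; apply/measurable_EFinP.
    by apply: (measurableT_comp (measurable_powR _)); exact: measurableT_comp.
  - apply: measurableT_comp => //; apply/measurable_EFinP.
    by apply: (measurableT_comp (measurable_powR _)); exact: measurableT_comp.
  - move=> x _ /=; rewrite lee_fin.
    by rewrite (ger0_norm (powR_ge0 _ r)) -powRrM rp ler_norm.
have [_] := rnorm_hoelder p0 q0 pq lfr (Lfun_cst1 1 q0).
rewrite rnorm_cst// normr1 mulr1; under eq_Rintegral do rewrite mulr1.
rewrite rnorm_comp_powR// rp -rnorm_powR// ger0_norm ?powR_ge0//.
by rewrite (ler_powRl r0) ?rnorm_ge0.
Qed.

End MassOne.
End RealNorm.

(** * Symmetric Markov semigroups *)

(** A semigroup of Markov kernels that is symmetric in L^2(mu) and contracts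
    every L^p(mu), for finite p. *)
Record symmetric_semigroup (R : realType) d (T : measurableType d)
    (mu : probability T R) (P : R -> R.-pker T ~> T) : Prop := {
  semigroup_0 : forall x (B : set T), measurable B -> P 0 x B = \d_x B ;
  semigroup_comp : forall s t, 0 <= s -> 0 <= t -> forall x,
    kernel_image (P t) (P s x) (P (s + t) x) ;
  semigroup_sym : forall f g, f \in Lfun mu 2%:E -> g \in Lfun mu 2%:E ->
    forall t, 0 <= t ->
    \int[mu]_x (f x * kernel_op (P t) g x) =
    \int[mu]_x (g x * kernel_op (P t) f x) ;
  semigroup_contraction : forall p : R, 1 <= p ->
    forall f, f \in Lfun mu p%:E -> forall t, 0 <= t ->
    ('N[mu]_p%:E[EFin \o kernel_op (P t) f] <= 'N[mu]_p%:E[EFin \o f])%E }.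

(** Bounded measurable functions, on which the kernels act pointwise. *)
Definition bounded_measurable (R : realType) d (T : measurableType d)
    (f : T -> R) : Prop :=
  measurable_fun setT f /\ exists M, forall x, `|f x| <= M.

Section BoundedMeasurable.
Context (R : realType) d (T : measurableType d).
Implicit Types (f g : T -> R).

Lemma bounded_cst (c : R) : bounded_measurable (cst c : T -> R).
Proof. by split => //; exists `|c|. Qed.

Lemma bounded_sub f g : bounded_measurable f -> bounded_measurable g ->
  bounded_measurable (f \- g).
Proof.
move=> [mf [M fM]] [mg [N gN]]; split; first exact: measurable_funB.
by exists (M + N) => x; apply: le_trans (ler_normB _ _) _; rewrite lerD.
Qed.

Lemma bounded_powR (a : R) f : 0 <= a -> bounded_measurable f ->
  bounded_measurable (fun x => `|f x| `^ a).
Proof.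
move=> a0 [mf [M fM]]; split.
  by apply: (measurableT_comp (measurable_powR _)); exact: measurableT_comp.
exists (M `^ a) => x; rewrite ger0_norm ?powR_ge0//.
have M0 : 0 <= M := le_trans (normr_ge0 _) (fM x).
exact: ge0_ler_powR.
Qed.

Lemma bounded_kernel_op (k : R.-pker T ~> T) f : bounded_measurable f ->
  bounded_measurable (kernel_op k f).
Proof.
move=> [mf [M fM]]; split; first exact: measurable_kernel_op.
by exists M; exact: kernel_op_bounded.
Qed.

Lemma bounded_integrable (nu : {measure set T -> \bar R}) f :
  nu setT = 1%E -> bounded_measurable f -> nu.-integrable setT (EFin \o f).
Proof. by move=> nu1 [mf [M fM]]; exact: integrable_bounded fM. Qed.

Lemma bounded_Lfun (nu : {measure set T -> \bar R}) (r : R) f :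
  nu setT = 1%E -> 0 < r -> bounded_measurable f -> f \in Lfun nu r%:E.
Proof. by move=> nu1 r0 [mf [M fM]]; exact: Lfun_bounded fM. Qed.

(** Jensen's inequality under the probability measures of a kernel. *)
Lemma kernel_op_jensen (k : R.-pker T ~> T) (a : R) f x : 1 <= a ->
  bounded_measurable f ->
  `|kernel_op k f x| `^ a <= kernel_op k (fun y => `|f y| `^ a) x.
Proof.
move=> a1 bf; have a0 : 0 < a by exact: lt_le_trans a1.
have k1 : k x setT = 1%E by exact: prob_kernel.
rewrite [leRHS](_ : _ = rnorm (k x) a f `^ a); last by rewrite rnorm_powR.
rewrite ler_powRl ?rnorm_ge0//.
apply: le_trans (rnorm_le k1 (lexx 1) a1 (bounded_Lfun k1 a0 bf)).
by rewrite rnorm1; apply: le_normr_Rintegral => //; exact: bounded_integrable.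
Qed.

End BoundedMeasurable.

Section SymmetricSemigroup.
Context (R : realType) d (T : measurableType d) (mu : probability T R).
Context (P : R -> R.-pker T ~> T) (SP : symmetric_semigroup mu P).
Implicit Types (f g h : T -> R) (s t p r : R).

Let mu1 : mu setT = 1%E := probability_setT mu.
Local Notation op t := (kernel_op (P t)).
Local Notation mean f := (\int[mu]_y f y).

(** Symmetry, tested on the constant 1, says that mu is invariant. *)
Lemma semigroup_invariant t : 0 <= t -> kernel_image (P t) mu mu.
Proof.
move=> t0 B mB.
have k1 x : (P t x B <= 1)%E.
  have <- : P t x setT = 1%E by exact: prob_kernel.
  by apply: le_measure; rewrite ?inE.
have bB : bounded_measurable (\1_B : T -> R).
  split; first exact: measurable_indic.
  by exists 1 => x; rewrite indicE normr_nat lern1 leq_b1.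
have l2B : (\1_B : T -> R) \in Lfun mu 2%:E by exact: bounded_Lfun.
have := semigroup_sym SP (Lfun_cst1 mu1 1 (ltr0n _ 2)) l2B t0.
rewrite kernel_op_cst /=; under eq_Rintegral do rewrite mul1r.
under [RHS]eq_Rintegral do rewrite mulr1.
rewrite /Rintegral integral_indic// setIT.
have -> : (\int[mu]_x (kernel_op (P t) \1_B x)%:E = \int[mu]_x P t x B)%E.
  apply: eq_integral => x _; rewrite /kernel_op /Rintegral.
  rewrite integral_indic// setIT fineK// ge0_fin_numE//.
  apply: (@le_lt_trans _ _ 1%E); last exact: ltry.
  exact: k1.
move=> meanE; have := congr1 EFin meanE; rewrite !fineK//.
- by rewrite ge0_fin_numE// (le_lt_trans (probability_le1 mu mB))// ltry.
- rewrite ge0_fin_numE ?integral_ge0//.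
  apply: (@le_lt_trans _ _ (\int[mu]_x (cst 1%E x))%E); last first.
    rewrite integral_cst// mul1e.
    exact: le_lt_trans (probability_le1 mu measurableT) (ltry 1).
  by apply: ge0_le_integral => //; exact: measurable_kernel.
Qed.

Lemma op0 f : measurable_fun setT f -> op 0 f = f.
Proof.
move=> mf; apply/funext => x; rewrite /kernel_op /Rintegral.
rewrite (eq_measure_integral \d_x); last first.
  by move=> A mA _; exact: (semigroup_0 SP).
have mF : measurable_fun setT (EFin \o f) by exact/measurable_EFinP.
by rewrite integral_dirac// diracT mul1e.
Qed.

Lemma op_Lfun p t f : 1 <= p -> 0 <= t -> f \in Lfun mu p%:E ->
  op t f \in Lfun mu p%:E.
Proof.
move=> p1 t0 lf; have [mf fy] := (LfunE mu p f).1 lf; apply/LfunE; split.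
  exact: measurable_kernel_op.
exact: le_lt_trans (semigroup_contraction SP p1 lf t0) fy.
Qed.

Lemma rnorm_op p t f : 1 <= p -> 0 <= t -> f \in Lfun mu p%:E ->
  rnorm mu p (op t f) <= rnorm mu p f.
Proof.
move=> p1 t0 lf; rewrite -lee_fin !EFin_rnorm//; last exact: op_Lfun.
exact: (semigroup_contraction SP).
Qed.

Lemma mean_op t f : 0 <= t -> mu.-integrable setT (EFin \o f) ->
  mean (op t f) = mean f.
Proof. by move=> t0; apply: Rintegral_kernel_op; exact: semigroup_invariant. Qed.

Lemma opB_ae t f g : 0 <= t -> mu.-integrable setT (EFin \o f) ->
  mu.-integrable setT (EFin \o g) ->
  {ae mu, forall x, op t (f \- g) x = op t f x - op t g x}.
Proof.
move=> t0 fi gi; have inv := semigroup_invariant t0.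
apply: filterS2 (ae_integrable_kernel inv fi) (ae_integrable_kernel inv gi) => x.
exact: kernel_opB_at.
Qed.

Lemma op_comp_ae s t f : 0 <= s -> 0 <= t -> mu.-integrable setT (EFin \o f) ->
  {ae mu, forall x, op (s + t) f x = op s (op t f) x}.
Proof.
move=> s0 t0 fi; have inv := semigroup_invariant (addr_ge0 s0 t0).
apply: filterS (ae_integrable_kernel inv fi) => x.
exact: (kernel_op_comp (semigroup_comp SP s0 t0 x)).
Qed.

Lemma op_comp_bounded s t f : 0 <= s -> 0 <= t -> bounded_measurable f ->
  op (s + t) f = op s (op t f).
Proof.
move=> s0 t0 bf; apply/funext => x.
apply: (kernel_op_comp (semigroup_comp SP s0 t0 x)).
by apply: bounded_integrable => //; exact: prob_kernel.
Qed.

Lemma opB_bounded t f g : bounded_measurable f -> bounded_measurable g ->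
  op t (f \- g) = op t f \- op t g.
Proof.
move=> bf bg; apply/funext => x.
by apply: kernel_opB_at; apply: bounded_integrable => //; exact: prob_kernel.
Qed.

End SymmetricSemigroup.

(** * Exponential decay of bounded functions *)

(** Exponential decay of the L^p norm of centred bounded functions. The
    normalization 1 <= K loses nothing, K being part of an upper bound. *)
Definition bounded_decay (R : realType) d (T : measurableType d)
    (mu : probability T R) (P : R -> R.-pker T ~> T) (p : R) : Prop :=
  exists lambda K : R, [/\ 0 < lambda, 1 <= K &
    forall f, bounded_measurable f -> \int[mu]_x f x = 0 -> forall t, 0 <= t ->
      rnorm mu p (kernel_op (P t) f) <=
        K * expR (- lambda * t) * rnorm mu p f].

Section BoundedDecay.
Context (R : realType) d (T : measurableType d) (mu : probability T R).
Context (P : R -> R.-pker T ~> T) (SP : symmetric_semigroup mu P).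
Implicit Types (f g h : T -> R) (s t p q r : R).

Let mu1 : mu setT = 1%E := probability_setT mu.
Local Notation op t := (kernel_op (P t)).
Local Notation mean f := (\int[mu]_y f y).

Lemma rnorm_le_bounded r f g : 1 <= r -> bounded_measurable f ->
  bounded_measurable g -> (forall x, `|f x| <= `|g x|) ->
  rnorm mu r f <= rnorm mu r g.
Proof.
move=> r1 bf bg fg; have r0 : 0 < r by exact: lt_le_trans r1.
rewrite -(ler_powRl r0 (rnorm_ge0 mu r f) (rnorm_ge0 mu r g)).
rewrite (rnorm_powR mu f r0) (rnorm_powR mu g r0).
apply: le_Rintegral => //.
- by apply: bounded_integrable => //; apply: bounded_powR => //; exact: ltW.
- by apply: bounded_integrable => //; apply: bounded_powR => //; exact: ltW.
- by move=> x _; apply: ge0_ler_powR => //; exact: ltW.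
Qed.

Lemma normr_mean_le r f : 1 <= r -> f \in Lfun mu r%:E ->
  `|mean f| <= rnorm mu r f.
Proof.
move=> r1 lf; apply: le_trans (rnorm_le mu1 (lexx 1) r1 lf).
by rewrite rnorm1; apply: le_normr_Rintegral => //; exact: Lfun_int lf.
Qed.

(** The decay propagates from q to the exponents p = a q with 1 <= a <= q.
    Half of the time is spent in Jensen's inequality |P_s u|^a <= P_s g for
    u = P_s f and g = |u|^a. In P_s g, the centred part of g decays by
    assumption, and the mean of g is the a-th power of the L^a norm of u,
    at most that of its L^q norm, which decays as well. *)
Lemma bounded_decay_up q p : 1 <= q -> q <= p -> p <= q * q ->
  bounded_decay mu P q -> bounded_decay mu P p.
Proof.
move=> q1 qp pqq [l [K [l0 K1 dec]]].
have q0 : 0 < q by exact: lt_le_trans q1.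
have p1 : 1 <= p by exact: le_trans qp.
have p0 : 0 < p by exact: lt_le_trans p1.
have K0 : 0 < K by exact: lt_le_trans K1.
pose a := p / q.
have aq : a * q = p by rewrite /a divfK// gt_eqF.
have a1 : 1 <= a by rewrite /a ler_pdivlMr// mul1r.
have aleq : a <= q by rewrite /a ler_pdivrMr.
have a0 : 0 < a by exact: lt_le_trans a1.
(* C is the constant of the bound on the norm of P_s g; the exponent a^-1 comes
   from |P_s u|^a <= P_s g, and the factor 2 in the rate from s = t / 2. *)
pose C := 2 * K + K `^ a.
have C1 : 1 <= C.
  have : 0 <= K `^ a by exact: powR_ge0.
  by rewrite /C; lra.
have C0 : 0 < C by exact: lt_le_trans C1.
exists (l / (2 * a)), (C `^ a^-1); split.
- by rewrite divr_gt0// mulr_gt0.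
- have : 1 `^ a^-1 <= C `^ a^-1 by rewrite ler_powRl ?invr_gt0// ltW.
  by rewrite powR1.
move=> f bf f0 t t0; pose s := t / 2.
have s0 : 0 <= s by rewrite divr_ge0.
have ts : t = s + s by rewrite /s; lra.
pose u := op s f; pose g := (fun x => `|u x| `^ a); pose c := mean g.
have bu : bounded_measurable u by exact: bounded_kernel_op.
have bg : bounded_measurable g by exact: bounded_powR (ltW a0) bu.
have bG : bounded_measurable (g \- cst c) by apply: bounded_sub => //; exact: bounded_cst.
have bL h r : 0 < r -> bounded_measurable h -> h \in Lfun mu r%:E.
  by move=> r0; exact: bounded_Lfun.
pose N := rnorm mu p f `^ a; pose e := expR (- l * s).
have N0 : 0 <= N by exact: powR_ge0.
have e0 : 0 < e by exact: expR_gt0.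
have Ke0 : 0 <= K * e by rewrite ltW// mulr_gt0.
have [K0' e0'] := (ltW K0, ltW e0).
have e1 : e <= 1 by rewrite /e -expR0 ler_expR mulNr oppr_le0 mulr_ge0// ltW.
have gN : rnorm mu q g <= N.
  rewrite rnorm_comp_powR// aq ler_powRl ?rnorm_ge0//.
  by apply: (rnorm_op SP) => //; exact: bL.
have c0 : 0 <= c by apply: Rintegral_ge0 => x _; exact: powR_ge0.
have cg : c <= rnorm mu q g.
  by rewrite -(ger0_norm c0); apply: normr_mean_le => //; exact: bL.
have cN : c <= K `^ a * e * N.
  rewrite /c -rnorm_powR//.
  apply: (@le_trans _ _ ((K * e * rnorm mu p f) `^ a)).
    rewrite ler_powRl ?rnorm_ge0//; last by rewrite mulr_ge0 ?rnorm_ge0.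
    apply: le_trans (rnorm_le mu1 a1 aleq (bL _ _ q0 bu)) _.
    apply: le_trans (dec f bf f0 s s0) _.
    rewrite ler_pM2l ?mulr_gt0//.
    exact: (rnorm_le mu1 q1 qp (bL _ _ p0 bf)).
  rewrite powRM ?rnorm_ge0// powRM//.
  rewrite ler_wpM2r// ler_wpM2l ?powR_ge0//.
  by rewrite ge1r_powR// e0.
have GN : rnorm mu q (op s (g \- cst c)) <= K * e * (2 * N).
  have G0 : mean (g \- cst c) = 0.
    have gi := bounded_integrable mu1 bg.
    have ci := bounded_integrable mu1 (bounded_cst T c).
    by rewrite RintegralB// (mean_cst mu1) subrr.
  apply: le_trans (dec _ bG G0 s s0) _.
  rewrite ler_pM2l ?mulr_gt0//.
  apply: le_trans (rnormB q1 (bL _ _ q0 bg) (Lfun_cst1 mu1 c q0)) _.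
  by rewrite rnorm_cst// ger0_norm//; lra.
have main : rnorm mu p (op t f) `^ a <= C * e * N.
  rewrite -aq -rnorm_comp_powR//.
  apply: (@le_trans _ _ (rnorm mu q (op s g))).
    apply: rnorm_le_bounded; first exact: q1.
    - by apply: bounded_powR (ltW a0) _; exact: bounded_kernel_op.
    - exact: bounded_kernel_op.
    move=> x; rewrite (ger0_norm (powR_ge0 _ _)) ts (op_comp_bounded SP)//.
    by apply: le_trans (ler_norm _); exact: kernel_op_jensen.
  rewrite (@eq_rnorm _ _ _ mu q _ (op s (g \- cst c) \+ cst c)); last first.
    move=> x; rewrite (opB_bounded P s bg (bounded_cst T c)) kernel_op_cst.
    by rewrite /= subrK.
  apply: le_trans (rnormD q1 (bL _ _ q0 _) (Lfun_cst1 mu1 c q0)) _.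
    exact: bounded_kernel_op.
  rewrite rnorm_cst// ger0_norm//.
  apply: le_trans (lerD GN cN) _.
  by rewrite /C; lra.
rewrite -(ler_powRl a0) ?rnorm_ge0//; last first.
  by rewrite !mulr_ge0 ?rnorm_ge0 ?powR_ge0 ?expR_ge0.
rewrite powRM ?rnorm_ge0 ?mulr_ge0 ?powR_ge0 ?expR_ge0//.
rewrite powRM ?powR_ge0 ?expR_ge0// -powRrM mulVf ?gt_eqF// powRr1; last exact: ltW.
suff -> : expR (- (l / (2 * a)) * t) `^ a = e by [].
rewrite -expRM; congr expR; rewrite /s.
by field; rewrite gt_eqF.
Qed.

(** Decay is self-dual: for u = P_t f, the function g = u |u|^(q-2) norms u,
    and by symmetry the pairing of u and g is that of f and P_t g, where g can
    be centred because f is. *)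
Lemma bounded_decay_dual p q : 1 < p -> 1 < q -> p^-1 + q^-1 = 1 ->
  bounded_decay mu P p -> bounded_decay mu P q.
Proof.
move=> p1 q1 pq [l [K [l0 K1 dec]]].
have p0 : 0 < p by exact: lt_trans p1.
have q0 : 0 < q by exact: lt_trans q1.
have K0 : 0 < K by exact: lt_le_trans K1.
exists l, (2 * K); split=> //; first by lra.
move=> f bf f0 t t0; set u := op t f; set e := expR _.
have e0 : 0 < e by exact: expR_gt0.
have bu : bounded_measurable u by exact: bounded_kernel_op.
(* Where u vanishes so does g, whatever the value of the negative power of 0. *)
pose g := fun x => u x * `|u x| `^ (q - 2).
have gE x : `|g x| = `|u x| `^ (q - 1).
  rewrite /g normrM (ger0_norm (powR_ge0 _ _)).
  have -> : q - 2 = q - 1 - 1 by lra.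
  by rewrite mulr_powRB1// subr_gt0.
have bg : bounded_measurable g.
  split.
    apply: measurable_funM; first exact: bu.1.
    by apply: (measurableT_comp (measurable_powR _)); apply: measurableT_comp bu.1.
  have q10 : 0 <= q - 1 by lra.
  have [_ [M uM]] := bounded_powR q10 bu.
  exists M => x; rewrite gE; apply: le_trans (uM x); exact: ler_norm.
have bL h r : 0 < r -> bounded_measurable h -> h \in Lfun mu r%:E.
  by move=> r0; exact: bounded_Lfun.
pose c := mean g; have bc := bounded_cst T c.
have bG : bounded_measurable (g \- cst c) by exact: bounded_sub.
have iG := bounded_integrable mu1 bG.
have G0 : mean (g \- cst c) = 0.
  have gi := bounded_integrable mu1 bg.
  have ci := bounded_integrable mu1 bc.
  by rewrite RintegralB// (mean_cst mu1) subrr.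
set X := rnorm mu q u; set Y := rnorm mu q f.
have X0 : 0 <= X by exact: rnorm_ge0.
have Y0 : 0 <= Y by exact: rnorm_ge0.
have gX : rnorm mu p g = X `^ (q - 1).
  have qE : q = (q - 1) * p.
    have : p * q * (p^-1 + q^-1) = p * q by rewrite pq mulr1.
    rewrite mulrDr mulrAC divff ?gt_eqF// mul1r mulfK ?gt_eqF// => E.
    by move: E; lra.
  have q10 : 0 < q - 1 by lra.
  rewrite /X [in rnorm mu q u]qE -rnorm_comp_powR//.
  by rewrite -(rnorm_normr _ p g); apply: eq_rnorm => x; rewrite gE.
have pairing : X `^ q = \int[mu]_x (f x * op t (g \- cst c) x).
  have iP (h1 h2 : T -> R) : bounded_measurable h1 -> bounded_measurable h2 ->
      mu.-integrable setT (EFin \o (fun x => h1 x * h2 x)).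
    move=> [m1 [M1 h1M]] [m2 [M2 h2M]].
    apply: (@integrable_bounded _ _ _ _ _ (M1 * M2)) => //.
      exact: measurable_funM.
    by move=> x; rewrite normrM ler_pM.
  rewrite /X rnorm_powR//.
  transitivity (\int[mu]_x (g x * op t f x)).
    apply: eq_Rintegral => x _; rewrite -/u.
    have -> : g x * u x = `|u x| * `|g x|.
      rewrite /g normrM (ger0_norm (powR_ge0 _ _)) mulrA -normrM.
      by rewrite ger0_norm -?expr2 ?sqr_ge0// expr2 mulrAC.
    by rewrite gE mulr_powRB1.
  rewrite (semigroup_sym SP (bL _ 2 (ltr0n _ 2) bg) (bL _ 2 (ltr0n _ 2) bf) t0).
  have opG x : f x * op t g x = f x * op t (g \- cst c) x + f x * c.
    by rewrite (opB_bounded P t bg bc) kernel_op_cst /= -mulrDr subrK.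
  under eq_Rintegral do rewrite opG.
  have bPG : bounded_measurable (op t (g \- cst c)) by exact: bounded_kernel_op.
  rewrite RintegralD//; [|exact: iP|exact: (iP f (cst c))].
  by rewrite RintegralZr ?f0 ?mul0r ?addr0//; exact: bounded_integrable.
have main : X `^ q <= Y * (K * e * (2 * X `^ (q - 1))).
  have qp : q^-1 + p^-1 = 1 by rewrite addrC.
  have bPG : bounded_measurable (op t (g \- cst c)) by exact: bounded_kernel_op.
  rewrite pairing; apply: le_trans (ler_norm _) _.
  have [_ /le_trans] := rnorm_hoelder q0 p0 qp (bL _ _ q0 bf) (bL _ _ p0 bPG).
  apply; rewrite ler_wpM2l//.
  apply: le_trans (dec _ bG G0 t t0) _.
  rewrite ler_pM2l ?mulr_gt0//.
  apply: le_trans (rnormB (ltW p1) (bL _ _ p0 bg) (bL _ _ p0 bc)) _.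
  rewrite rnorm_cst// gX.
  have := normr_mean_le (ltW p1) (bL _ _ p0 bg).
  by rewrite gX -/c; lra.
have [X00|Xn0] := eqVneq X 0; first by rewrite X00 !mulr_ge0// ltW.
have Xq : 0 < X `^ (q - 1) by rewrite powR_gt0// lt0r Xn0.
rewrite -(ler_pM2r Xq) (mulr_powRB1 X0 q0); apply: le_trans main _.
by rewrite le_eqVlt; apply/orP; left; apply/eqP; ring.
Qed.

Lemma conjugate_exponent p : 1 < p ->
  1 < p / (p - 1) /\ p^-1 + (p / (p - 1))^-1 = 1.
Proof.
move=> p1; split; first by rewrite ltr_pdivlMr ?subr_gt0// mul1r; lra.
have p0 : 0 < p by exact: lt_trans p1.
by rewrite invf_div -{1}(div1r p) -mulrDl subrKC mulfV// gt_eqF.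
Qed.

(** Iterating the previous propagation by factors of at most q reaches every
    larger exponent. *)
Lemma bounded_decay_ge q p : 1 < q -> q <= p ->
  bounded_decay mu P q -> bounded_decay mu P p.
Proof.
move=> q1 qp decq; have q0 : 0 < q by exact: lt_trans q1.
have step n : forall r, q <= r -> r <= q ^+ n.+1 -> bounded_decay mu P r.
  elim: n => [r qr|n IH r qr rq].
    by rewrite expr1 => rq; have -> : r = q by apply/eqP; rewrite eq_le rq.
  have [rn|rn] := leP r (q ^+ n.+1); first exact: IH.
  case: n IH rq rn => [_ rq _|n IH rq rn].
    exact: (bounded_decay_up (ltW q1) qr rq).
  have rq1 : q <= r / q.
    rewrite ler_pdivlMr// -expr2; apply: le_trans (ltW rn).
    by apply: ler_weXn2l => //; exact: ltW.
  apply: (@bounded_decay_up (r / q)).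
  - exact: le_trans (ltW q1) rq1.
  - by rewrite ler_pdivrMr// ler_peMr ?(ltW q1)// (le_trans (ltW q0)).
  - have rE : q * (r / q) = r by rewrite mulrC divfK// gt_eqF.
    by rewrite -{1}rE ler_wpM2r// (le_trans (ltW q0)).
  - by apply: IH => //; rewrite ler_pdivrMr// -exprSr.
have [n pn] : exists n : nat, p <= q ^+ n.+1.
  (* Bernoulli's inequality *)
  have bernoulli m : 1 + m%:R * (q - 1) <= q ^+ m.
    elim: m => [|m IH]; first by rewrite mul0r addr0.
    rewrite exprS; apply: le_trans (ler_wpM2l (ltW q0) IH).
    have := mulr_ge0 (ler0n R m) (sqr_ge0 (q - 1)).
    by rewrite -(natr1 m) expr2; set b := m%:R; lra.
  have p0 : 0 <= p by exact: le_trans (ltW q0) qp.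
  have q10 : 0 < q - 1 by rewrite subr_gt0.
  exists (Num.bound (p / (q - 1))); apply: le_trans (bernoulli _).
  have := archi_boundP (divr_ge0 p0 (ltW q10)).
  rewrite ltr_pdivrMr// => pn; rewrite -natr1 mulrDl mul1r.
  by move: pn; set b := _ * _; lra.
exact: step qp pn.
Qed.

(** One of two conjugate exponents is at most 2, so the decay passes through
    the exponent 2. *)
Lemma bounded_decay_all q p : 1 < q -> 1 < p ->
  bounded_decay mu P q -> bounded_decay mu P p.
Proof.
move=> q1 p1 decq.
have lt12 : (1 : R) < 2 by rewrite ltr1n.
have dec2 : bounded_decay mu P 2.
  have [q2|q2] := leP q 2; first exact: (bounded_decay_ge q1).
  have [c1 cE] := conjugate_exponent q1.
  apply: (bounded_decay_ge c1); last exact: (bounded_decay_dual q1 c1).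
  by rewrite ler_pdivrMr ?subr_gt0//; lra.
have [p2|p2] := leP 2 p; first exact: (bounded_decay_ge lt12 _ dec2).
have [c1 cE] := conjugate_exponent p1.
apply: (bounded_decay_dual c1 p1); first by rewrite addrC.
apply: (bounded_decay_ge lt12 _ dec2) => //.
by rewrite ler_pdivlMr ?subr_gt0//; lra.
Qed.

End BoundedDecay.

(** * From bounded functions to all of L^p *)

Section Density.
Context (R : realType) d (T : measurableType d) (mu : probability T R).
Implicit Types (f g : T -> R).

Let mu1 : mu setT = 1%E := probability_setT mu.

(** Bounded functions are dense in L^p: the truncations f 1_{|f| <= n} converge to
    f by dominated convergence. *)
Lemma bounded_dense (p : R) f (e : R) : 1 <= p -> f \in Lfun mu p%:E -> 0 < e ->
  exists2 g, bounded_measurable g & rnorm mu p (f \- g) < e.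
Proof.
move=> p1 lf e0; have p0 : 0 < p by exact: lt_le_trans p1.
have mf := Lfun_measurable lf.
pose g (n : nat) : T -> R := fun x => f x * \1_[set y | `|f y| <= n%:R] x.
have mI n : measurable [set y | `|f y| <= n%:R].
  have mnf : measurable_fun setT (EFin \o (fun y => `|f y|)).
    by apply/measurable_EFinP; exact: measurableT_comp.
  have := emeasurable_fun_infty_c measurableT mnf n%:R%:E; rewrite setTI.
  by congr measurable; apply/seteqP; split=> y /=; rewrite lee_fin.
have mg n : measurable_fun setT (g n).
  by apply: measurable_funM => //; exact: measurable_indic.
have bg n : bounded_measurable (g n).
  split => //; exists n%:R => x; rewrite /g indicE.
  have [|_] := boolP (x \in _); last by rewrite mulr0 normr0.
  by rewrite inE mulr1.
pose h n x := (`|f x - g n x| `^ p)%:E.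
have mh n : measurable_fun setT (h n).
  apply/measurable_EFinP; apply: (measurableT_comp (measurable_powR _)).
  by apply: measurableT_comp => //; exact: measurable_funB.
have hlim x : h ^~ x @ \oo --> (cst 0%E : T -> \bar R) x.
  apply: cvg_near_cst.
  exists (Num.bound `|f x|) => // n /= fn.
  have fxn : `|f x| <= n%:R.
    apply: le_trans (ltW (archi_boundP (normr_ge0 (f x)))) _.
    by rewrite ler_nat.
  by rewrite /h /g indicE mem_set// mulr1 subrr normr0 powR0// gt_eqF.
have hdom n x : (`|h n x| <= (`|f x| `^ p)%:E)%E.
  rewrite /h gee0_abs ?lee_fin ?powR_ge0//.
  rewrite ler_powRl// /g indicE.
  by case: (_ \in _); rewrite ?mulr1 ?mulr0 ?subr0// subrr normr0.
have [_ _ ] := @dominated_convergence _ _ _ mu setT measurableT h (cst 0%E)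
  (fun x => (`|f x| `^ p)%:E) mh (measurable_cst _)
  (aeW mu (fun x _ => hlim x)) (Lfun_integrable p1 lf)
  (aeW mu (fun x n _ => hdom n x)).
rewrite integral0 => /fine_cvg /= cvg0.
have ep0 : 0 < e `^ p by exact: powR_gt0.
have /cvgr0_norm_lt/(_ _ ep0) [n _ /(_ n (leqnn n))] := cvg0 => /= hn.
exists (g n) => //.
rewrite ltNge -(ler_powRl p0 (ltW e0) (rnorm_ge0 _ _ _)) rnorm_powR//.
by rewrite -ltNge; apply: le_lt_trans hn; exact: ler_norm.
Qed.

End Density.

(** The centred L^r norm N_r, as a real number. *)
Definition cnorm (R : realType) d (T : measurableType d)
    (mu : {measure set T -> \bar R}) (r : R) (f : T -> R) : R :=
  rnorm mu r (fun x => f x - \int[mu]_y f y).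

(** Exponential decay of the centred norm on the whole of L^p: the real-valued
    form of [exponential_decay]. *)
Definition Lp_decay (R : realType) d (T : measurableType d)
    (mu : probability T R) (P : R -> R.-pker T ~> T) (p : R) : Prop :=
  exists lambda K : R, 0 < lambda /\
    forall f, f \in Lfun mu p%:E -> forall t, 0 <= t ->
      cnorm mu p (kernel_op (P t) f) <= K * expR (- lambda * t) * cnorm mu p f.

Section LpDecay.
Context (R : realType) d (T : measurableType d) (mu : probability T R).
Context (P : R -> R.-pker T ~> T) (SP : symmetric_semigroup mu P).
Implicit Types (f g h : T -> R) (s t p q r : R).

Let mu1 : mu setT = 1%E := probability_setT mu.
Local Notation op t := (kernel_op (P t)).
Local Notation mean f := (\int[mu]_y f y).

Lemma Lfun_center p f : 1 <= p -> f \in Lfun mu p%:E ->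
  (fun x => f x - mean f) \in Lfun mu p%:E.
Proof.
move=> p1 lf; apply: (LfunB p1 lf).
by apply: (Lfun_cst1 mu1); exact: lt_le_trans p1.
Qed.

Lemma cnorm_centered p f : mean f = 0 -> cnorm mu p f = rnorm mu p f.
Proof. by move=> f0; apply: eq_rnorm => x; rewrite f0 subr0. Qed.

Lemma meanB f g : mu.-integrable setT (EFin \o f) ->
  mu.-integrable setT (EFin \o g) -> mean (f \- g) = mean f - mean g.
Proof. by move=> fi gi; rewrite RintegralB. Qed.

Lemma mean_center p f : 1 <= p -> f \in Lfun mu p%:E ->
  mean (fun x => f x - mean f) = 0.
Proof.
move=> p1 lf; have fi := Lfun_int mu1 p1 lf.
have ci := bounded_integrable mu1 (bounded_cst T (mean f)).
by rewrite RintegralB// (mean_cst mu1) subrr.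
Qed.

Lemma cnorm_le p f : 1 <= p -> f \in Lfun mu p%:E ->
  cnorm mu p f <= 2 * rnorm mu p f.
Proof.
move=> p1 lf; have p0 : 0 < p by exact: lt_le_trans p1.
apply: le_trans (rnormB p1 lf (Lfun_cst1 mu1 (mean f) p0)) _.
rewrite rnorm_cst//; have := normr_mean_le p1 lf; lra.
Qed.

Lemma cnorm_sub p f g : 1 <= p -> f \in Lfun mu p%:E -> g \in Lfun mu p%:E ->
  cnorm mu p f <= cnorm mu p g + 2 * rnorm mu p (f \- g).
Proof.
move=> p1 lf lg.
have lfg := LfunB p1 lf lg.
apply: le_trans (rnorm_sub p1 (Lfun_center p1 lf) (Lfun_center p1 lg)) _.
rewrite lerD2l; apply: le_trans (cnorm_le p1 lfg).
rewrite le_eqVlt; apply/orP; left; apply/eqP; apply: eq_rnorm => x /=.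
by rewrite meanB ?(Lfun_int mu1 p1)//; ring.
Qed.

Lemma rnorm_opB p t f g : 1 <= p -> 0 <= t -> f \in Lfun mu p%:E ->
  g \in Lfun mu p%:E ->
  rnorm mu p (op t f \- op t g) <= rnorm mu p (f \- g).
Proof.
move=> p1 t0 lf lg; have p0 : 0 < p by exact: lt_le_trans p1.
apply: le_trans (rnorm_op SP p1 t0 (LfunB p1 lf lg)).
have mP h : h \in Lfun mu p%:E -> measurable_fun setT (op t h).
  by move=> lh; apply: measurable_kernel_op; exact: Lfun_measurable lh.
rewrite le_eqVlt; apply/orP; left; apply/eqP; apply: ae_eq_rnorm => //.
- by apply: measurable_funB; exact: mP.
- exact: mP (LfunB p1 lf lg).
apply: filterS (opB_ae SP t0 (Lfun_int mu1 p1 lf) (Lfun_int mu1 p1 lg)) => x.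
by move=> ->.
Qed.

Lemma Lp_decay_bounded p : 1 <= p -> Lp_decay mu P p -> bounded_decay mu P p.
Proof.
move=> p1 [l [K [l0 dec]]]; exists l, (`|K| + 1); split => //.
  by rewrite lerDr.
move=> f bf f0 t t0; have p0 : 0 < p by exact: lt_le_trans p1.
have lf := bounded_Lfun mu1 p0 bf.
have fi := Lfun_int mu1 p1 lf.
have := dec f lf t t0; rewrite !cnorm_centered//; last by rewrite (mean_op SP).
move=> /le_trans; apply; rewrite ler_wpM2r ?rnorm_ge0//.
rewrite ler_wpM2r ?expR_ge0//; apply: le_trans (ler_norm K) _.
by rewrite lerDl.
Qed.

(** The decay extends from the bounded functions by density, both sides being
    Lipschitz in L^p. *)
Lemma bounded_decay_Lp p : 1 <= p -> bounded_decay mu P p -> Lp_decay mu P p.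
Proof.
move=> p1 [l [K [l0 K1 dec]]]; exists l, K; split => // f lf t t0.
have p0 : 0 < p by exact: lt_le_trans p1.
have K0 : 0 < K by exact: lt_le_trans K1.
set a := K * _; have a0 : 0 <= a by rewrite mulr_ge0 ?expR_ge0// ltW.
have bdec g : bounded_measurable g -> cnorm mu p (op t g) <= a * cnorm mu p g.
  move=> bg; have lg := bounded_Lfun mu1 p0 bg.
  have bc := bounded_cst T (mean g).
  have bG : bounded_measurable (fun x => g x - mean g) by exact: bounded_sub bg bc.
  have := dec _ bG (mean_center p1 lg) t t0; apply: le_trans.
  rewrite le_eqVlt; apply/orP; left; apply/eqP; apply: eq_rnorm => x /=.
  rewrite (mean_op SP t0 (Lfun_int mu1 p1 lg)).
  by rewrite (opB_bounded P t bg bc) kernel_op_cst.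
apply/ler_addgt0Pr => e e0; pose e' := e / (2 * a + 2).
have e'0 : 0 < e' by rewrite divr_gt0//; lra.
have [g bg fg] := bounded_dense p1 lf e'0.
have lg := bounded_Lfun mu1 p0 bg.
have Pf := op_Lfun SP p1 t0 lf; have Pg := op_Lfun SP p1 t0 lg.
apply: le_trans (cnorm_sub p1 Pf Pg) _.
have h1 := rnorm_opB p1 t0 lf lg.
have h2 := bdec g bg.
have h3 := cnorm_sub p1 lg lf; rewrite rnormBC in h3.
have h4 : a * cnorm mu p g <= a * (cnorm mu p f + 2 * e').
  by rewrite ler_wpM2l//; apply: le_trans h3 _; rewrite lerD2l ler_wpM2l// ltW.
have h5 : e = 2 * a * e' + 2 * e'.
  by rewrite /e'; field; apply: lt0r_neq0; lra.
move: h1 h2 h4 fg h5; rewrite mulrDr; lra.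
Qed.

End LpDecay.

(** * The Poincare inequality and the decay in L^2 *)

(** An inequality that holds up to a multiple of every small error. *)
Lemma ler_eps (R : realType) (x y c : R) : 0 <= c ->
  (forall e, 0 < e -> e <= 1 -> x <= y + c * e) -> x <= y.
Proof.
move=> c0 H; apply/ler_addgt0Pr => e e0.
pose e' := Num.min 1 (e / (c + 1)).
have e'0 : 0 < e' by rewrite lt_min ltr01 divr_gt0//; lra.
have e'1 : e' <= 1 by rewrite ge_min lexx.
apply: le_trans (H e' e'0 e'1) _; rewrite lerD2l.
have : e' <= e / (c + 1) by rewrite ge_min lexx orbT.
by rewrite ler_pdivlMr; nra.
Qed.

(** Slopes of a convex sequence: the first one bounds the mean slope up to n,
    which bounds the n-th one. *)
Lemma convex_seq_slope (R : realType) (a : nat -> R) n :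
  (forall k, a k.+1 - a k.+2 <= a k - a k.+1) ->
  a 0 - a n <= n%:R * (a 0 - a 1) /\ n%:R * (a n - a n.+1) <= a 0 - a n.
Proof.
move=> cvx.
have le0 k : a k - a k.+1 <= a 0 - a 1.
  by elim: k => [//|k IH]; exact: le_trans (cvx k) IH.
elim: n => [|n [IH1 IH2]]; first by rewrite !mul0r subrr.
have n0 : (0 : R) <= n%:R by exact: ler0n.
rewrite -(natr1 n) !mulrDl !mul1r; split.
  by have := le0 n; lra.
have := ler_wpM2l n0 (cvx n); have := cvx n; lra.
Qed.

Section L2.
Context (R : realType) d (T : measurableType d) (mu : probability T R).
Implicit Types (f g h u v w : T -> R).

Let mu1 : mu setT = 1%E := probability_setT mu.
Local Notation L2 := (Lfun mu 2%:E).
Local Notation nm := (rnorm mu 2).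
Local Notation N := (cnorm mu 2).
Local Notation mean f := (\int[mu]_y f y).
Local Notation ip f g := (\int[mu]_x (f x * g x)).

Let le12 : (1 : R) <= 2. Proof. by rewrite ler1n. Qed.
Let lt02 : (0 : R) < 2. Proof. by rewrite ltr0n. Qed.

Lemma ip_integrable f g : f \in L2 -> g \in L2 ->
  mu.-integrable setT (EFin \o (fun x => f x * g x)).
Proof. by move=> lf lg; apply/Lfun1_integrable; exact: Lfun2_mul_Lfun1. Qed.

Lemma ipC f g : ip f g = ip g f.
Proof. by apply: eq_Rintegral => x _; rewrite mulrC. Qed.

Lemma ipBl f g h : f \in L2 -> g \in L2 -> h \in L2 ->
  ip (f \- g) h = ip f h - ip g h.
Proof.
move=> lf lg lh; rewrite -RintegralB//; [|exact: ip_integrable..].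
by apply: eq_Rintegral => x _; rewrite mulrBl.
Qed.

Lemma ipBr f g h : f \in L2 -> g \in L2 -> h \in L2 ->
  ip h (f \- g) = ip h f - ip h g.
Proof. by move=> lf lg lh; rewrite ipC ipBl// !(ipC h). Qed.

Lemma ipZr c f g : f \in L2 -> g \in L2 -> ip f (fun x => c * g x) = c * ip f g.
Proof.
move=> lf lg; rewrite -RintegralZl//; last exact: ip_integrable.
by apply: eq_Rintegral => x _; rewrite mulrCA.
Qed.

Lemma ip_self_sub f g : f \in L2 -> g \in L2 ->
  ip (f \- g) (f \- g) = ip f f - 2 * ip f g + ip g g.
Proof.
move=> lf lg; have lfg := LfunB le12 lf lg.
rewrite (ipBl lf lg lfg) (ipBr lf lg lf) (ipBr lf lg lg) (ipC g f).
by move: (ip f f) (ip f g) (ip g g) => a b c; ring.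
Qed.

Lemma ip_le f g : f \in L2 -> g \in L2 -> `|ip f g| <= nm f * nm g.
Proof.
move=> lf lg; have half : (2 : R)^-1 + 2^-1 = 1 by rewrite [RHS]splitr !div1r.
by have [] := rnorm_hoelder lt02 lt02 half lf lg.
Qed.

Lemma ip_self f : ip f f = nm f ^+ 2.
Proof.
rewrite -powR_mulrn ?rnorm_ge0// rnorm_powR//; apply: eq_Rintegral => x _.
by rewrite powR_mulrn// real_normK ?num_real// expr2.
Qed.

Lemma ae_eq_ip f g h : f \in L2 -> g \in L2 -> h \in L2 ->
  {ae mu, forall x, g x = h x} -> ip f g = ip f h.
Proof.
move=> lf lg lh gh; rewrite /Rintegral; congr fine; apply: ae_eq_integral => //.
- exact: measurable_int (ip_integrable lf lg).
- exact: measurable_int (ip_integrable lf lh).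
- by apply: filterS gh => x -> _.
Qed.

(** The variance is the square of the centred norm. *)
Lemma cnorm_sqr f : f \in L2 -> N f ^+ 2 = ip f f - (mean f) ^+ 2.
Proof.
move=> lf; rewrite -ip_self; set c := mean f.
have lc := Lfun_cst1 mu1 c lt02.
have fi := Lfun_int mu1 le12 lf.
rewrite (ipBl lf lc (LfunB le12 lf lc)) !(ipBr lf lc)//.
have -> : ip f (cst c) = c * c by rewrite RintegralZr.
have -> : ip (cst c) f = c * c by rewrite ipC RintegralZr.
have -> : ip (cst c) (cst c) = c * c by exact: (mean_cst mu1 (c * c)).
by ring.
Qed.

Lemma ae_eq_cnorm p f g : 1 <= p -> f \in Lfun mu p%:E -> g \in Lfun mu p%:E ->
  {ae mu, forall x, f x = g x} -> cnorm mu p f = cnorm mu p g.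
Proof.
move=> p1 lf lg fg; have p0 : 0 < p by exact: lt_le_trans p1.
have -> : cnorm mu p f = rnorm mu p (fun x => f x - mean g).
  apply: eq_rnorm => x; congr (_ - _); rewrite /Rintegral; congr fine.
  apply: ae_eq_integral => //.
  - by apply/measurable_EFinP; exact: Lfun_measurable lf.
  - by apply/measurable_EFinP; exact: Lfun_measurable lg.
  - by apply: filterS fg => y -> _.
apply: ae_eq_rnorm => //.
- by apply: measurable_funB => //; exact: Lfun_measurable lf.
- by apply: measurable_funB => //; exact: Lfun_measurable lg.
- by apply: filterS fg => y ->.
Qed.

End L2.

(** [g] is the image of [f] under the L^2 generator: the difference quotients of
    P_t f at 0 converge to g in L^2. This is [L2_generator] with the limit
    spelled out in terms of the real-valued norm. *)
Definition generates (R : realType) d (T : measurableType d)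
    (mu : probability T R) (P : R -> R.-pker T ~> T) (f g : T -> R) : Prop :=
  [/\ f \in Lfun mu 2%:E, g \in Lfun mu 2%:E &
    forall e : R, 0 < e -> exists2 r, 0 < r & forall h, 0 < h -> h < r ->
      rnorm mu 2 (fun x => h^-1 * (kernel_op (P h) f x - f x) - g x) < e].

Section L2Semigroup.
Context (R : realType) d (T : measurableType d) (mu : probability T R).
Context (P : R -> R.-pker T ~> T) (SP : symmetric_semigroup mu P).
Implicit Types (f g u v w : T -> R) (s t e h : R).

Let mu1 : mu setT = 1%E := probability_setT mu.
Local Notation op t := (kernel_op (P t)).
Local Notation L2 := (Lfun mu 2%:E).
Local Notation nm := (rnorm mu 2).
Local Notation N := (cnorm mu 2).
Local Notation mean f := (\int[mu]_y f y).
Local Notation ip f g := (\int[mu]_x (f x * g x)).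

Let le12 : (1 : R) <= 2. Proof. by rewrite ler1n. Qed.
Let lt02 : (0 : R) < 2. Proof. by rewrite ltr0n. Qed.

Lemma op_L2 t f : 0 <= t -> f \in L2 -> op t f \in L2.
Proof. by move=> t0; exact: (op_Lfun SP). Qed.

Lemma ip_op s t f : 0 <= s -> 0 <= t -> f \in L2 ->
  ip (op s f) (op t f) = ip f (op (s + t) f).
Proof.
move=> s0 t0 lf; rewrite ipC (semigroup_sym SP (op_L2 t0 lf) lf s0).
apply: ae_eq_ip => //.
- by apply: op_L2 => //; exact: op_L2.
- by apply: op_L2 => //; exact: addr_ge0.
apply: filterS (op_comp_ae SP s0 t0 (Lfun_int mu1 le12 lf)) => x.
by move=> ->.
Qed.

(** t |-> <f, P_t f> is convex, because its second differences are squared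
    norms of the form |P_a f - P_b f|^2. *)
Lemma ip_op_convex s t f : 0 <= s -> 0 <= t -> f \in L2 ->
  ip f (op (s + t) f) - ip f (op (s + t + t) f) <=
  ip f (op s f) - ip f (op (s + t) f).
Proof.
move=> s0 t0 lf; pose a := s / 2; pose b := s / 2 + t.
have a0 : 0 <= a by rewrite divr_ge0.
have b0 : 0 <= b by rewrite addr_ge0.
have [la lb] := (op_L2 a0 lf, op_L2 b0 lf).
have : 0 <= ip (op a f \- op b f) (op a f \- op b f).
  by rewrite ip_self sqr_ge0.
rewrite (ip_self_sub la lb) (ip_op a0 a0 lf) (ip_op a0 b0 lf) (ip_op b0 b0 lf).
have -> : a + a = s by rewrite /a; lra.
have -> : a + b = s + t by rewrite /a /b; lra.
have -> : b + b = s + t + t by rewrite /b; lra.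
by move: (ip f (op s f)) (ip f (op (s + t) f)) (ip f _) => x y z; lra.
Qed.

Lemma op0_ip f : f \in L2 -> ip f (op 0 f) = ip f f.
Proof. by move=> lf; rewrite (op0 SP)//; exact: Lfun_measurable lf. Qed.

Lemma cnorm_sqr_op t f : 0 <= t -> f \in L2 ->
  N (op t f) ^+ 2 = ip f (op (t + t) f) - (mean f) ^+ 2.
Proof.
move=> t0 lf; rewrite cnorm_sqr ?ip_op//; last exact: op_L2.
by rewrite (mean_op SP)//; exact: Lfun_int lf.
Qed.

Lemma cnorm_op p t f : 1 <= p -> 0 <= t -> f \in Lfun mu p%:E ->
  cnorm mu p (op t f) <= cnorm mu p f.
Proof.
move=> p1 t0 lf; have p0 : 0 < p by exact: lt_le_trans p1.
have := rnorm_opB SP p1 t0 lf (Lfun_cst1 mu1 (mean f) p0).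
rewrite kernel_op_cst; apply: le_trans.
by rewrite /cnorm (mean_op SP t0 (Lfun_int mu1 p1 lf)).
Qed.

(** The slope at 0 of t |-> <f, P_t f> is <f, L f>. *)
Lemma generates_slope f g : generates mu P f g -> forall e, 0 < e ->
  exists2 r, 0 < r & forall h, 0 < h -> h < r ->
    `|h^-1 * (ip f f - ip f (op h f)) + ip f g| <= nm f * e.
Proof.
move=> [lf lg gen] e /gen [r r0 H]; exists r => // h h0 hr.
have lP := op_L2 (ltW h0) lf.
have lq : (fun x => h^-1 * (op h f x - f x)) \in L2.
  by apply: (LfunZ _ le12); exact: LfunB.
have lqg := LfunB le12 lq lg.
have := ip_le lf lqg; rewrite (ipBr lq lg lf).
rewrite (ipZr _ lf (LfunB le12 lP lf)) (ipBr lP lf lf) => le.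
rewrite -normrN; have -> : - (h^-1 * (ip f f - ip f (op h f)) + ip f g) =
    h^-1 * (ip f (op h f) - ip f f) - ip f g by ring.
apply: le_trans le _; rewrite ler_wpM2l ?rnorm_ge0//.
exact: ltW (H h h0 hr).
Qed.

(** A step t / (n + 1) below a prescribed bound. *)
Lemma small_step t r : 0 < t -> 0 < r -> exists n : nat, t / n.+1%:R < r.
Proof.
move=> t0 r0; exists (Num.bound (t / r)).
rewrite ltr_pdivrMr ?ltr0n// mulrC -ltr_pdivrMr//.
apply: lt_trans (archi_boundP (ltW (divr_gt0 t0 r0))) _.
by rewrite ltr_nat.
Qed.

(** Slopes of t |-> <f, P_t f> along multiples of a step h. *)
Lemma ip_op_slopes h f n : 0 <= h -> f \in L2 ->
  ip f f - ip f (op (n%:R * h) f) <= n%:R * (ip f f - ip f (op h f)) /\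
  n%:R * (ip f (op (n%:R * h) f) - ip f (op (n%:R * h + h) f)) <=
    ip f f - ip f (op (n%:R * h) f).
Proof.
move=> h0 lf; pose a (k : nat) := ip f (op (k%:R * h) f).
have aS k : a k.+1 = ip f (op (k%:R * h + h) f).
  by rewrite /a -natr1 mulrDl mul1r.
have a0 : a 0 = ip f f by rewrite /a mul0r op0_ip.
have a1 : a 1 = ip f (op h f) by rewrite /a mul1r.
have cvx k : a k.+1 - a k.+2 <= a k - a k.+1.
  have aSS : a k.+2 = ip f (op (k%:R * h + h + h) f).
    by rewrite aS -natr1 mulrDl mul1r.
  rewrite aSS aS; apply: (ip_op_convex _ h0 lf).
  by rewrite mulr_ge0.
by have := convex_seq_slope n cvx; rewrite a0 a1 aS.
Qed.

(** By convexity the mean slope of t |-> <f, P_t f> on [0, t] is at least its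
    slope at 0. *)
Lemma dissipation_le f g t : 0 < t -> generates mu P f g ->
  ip f f - ip f (op t f) <= t * - ip f g.
Proof.
move=> t0 gen; have [lf lg _] := gen.
apply: (@ler_eps _ _ _ (t * nm f)); first by rewrite mulr_ge0 ?rnorm_ge0 ?ltW.
move=> e e0 _; have [r r0 H] := generates_slope gen e0.
have [n nr] := small_step t0 r0; set m := n.+1%:R in nr.
have m0 : 0 < m by rewrite ltr0n.
have h0 : 0 < t / m by rewrite divr_gt0.
have mt : m * (t / m) = t by rewrite mulrCA divff ?mulr1// gt_eqF.
have := H _ h0 nr; rewrite ler_norml => /andP[_ slope].
have [+ _] := ip_op_slopes n.+1 (ltW h0) lf; rewrite -/m mt.
move=> cvx; apply: le_trans cvx _.
have -> : m * (ip f f - ip f (op (t / m) f)) =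
    t * ((t / m)^-1 * (ip f f - ip f (op (t / m) f))).
  by move: (ip f f - _) => z; field; rewrite !gt_eqF.
have := ler_wpM2l (ltW t0) slope; rewrite mulrDr; lra.
Qed.

Lemma dirichlet_form_ge0 f g : generates mu P f g -> 0 <= - ip f g.
Proof.
move=> gen; have [lf lg _] := gen.
have := dissipation_le ltr01 gen; rewrite mul1r; apply: le_trans.
rewrite subr_ge0; apply: le_trans (ler_norm _) _.
apply: le_trans (ip_le lf (op_L2 ler01 lf)) _.
rewrite ip_self expr2 ler_wpM2l ?rnorm_ge0//.
exact: (rnorm_op SP).
Qed.

(** P_s maps the domain of the generator into itself and commutes with it. *)
Lemma generates_op f g s : 0 <= s -> generates mu P f g ->
  generates mu P (op s f) (op s g).
Proof.
move=> s0 [lf lg gen]; split; [exact: op_L2|exact: op_L2|].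
move=> e /gen [r r0 H]; exists r => // h h0 hr.
apply: le_lt_trans (H h h0 hr).
have h0' := ltW h0.
have lP := op_L2 h0' lf; have lD := LfunB le12 lP lf.
have lq := LfunZ h^-1 le12 lD; have lqg := LfunB le12 lq lg.
apply: le_trans (rnorm_op SP le12 s0 lqg).
have fi u : u \in L2 -> mu.-integrable setT (EFin \o u) by exact: Lfun_int.
have sP := op_L2 h0' (op_L2 s0 lf).
rewrite le_eqVlt; apply/orP; left; apply/eqP; apply: ae_eq_rnorm => //.
- apply: (@Lfun_measurable _ _ _ mu 2); apply: LfunB => //; last exact: op_L2.
  by apply: (LfunZ _ le12); apply: LfunB => //; exact: op_L2.
- by apply: (@Lfun_measurable _ _ _ mu 2); exact: op_L2.
(* Almost everywhere, P_s commutes with the formation of difference quotients. *)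
have inv := semigroup_invariant SP s0.
have E1 := ae_integrable_kernel inv (fi _ lq).
have E2 := ae_integrable_kernel inv (fi _ lg).
have E3 := ae_integrable_kernel inv (fi _ lP).
have E4 := ae_integrable_kernel inv (fi _ lf).
have E5 := ae_integrable_kernel inv (fi _ lD).
have E6 := op_comp_ae SP s0 h0' (fi _ lf).
have E7 := op_comp_ae SP h0' s0 (fi _ lf).
apply: filterS3 (filterI E1 E2) (filterI E3 E4) (filterI E5 (filterI E6 E7)).
move=> x [i1 i2] [i3 i4] [i5 [c6 c7]].
rewrite (kernel_opB_at i1 i2) (kernel_opZ_at _ i5) (kernel_opB_at i3 i4).
by rewrite -c6 -c7 (addrC s h).
Qed.

(** By convexity the mean slope of t |-> <f, P_t f> on [0, t] is at most its slope
    at t, which is the slope at 0 for P_(t/2) f. *)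
Lemma dissipation_ge f g t : 0 < t -> generates mu P f g ->
  t * - ip (op (t / 2) f) (op (t / 2) g) <= ip f f - ip f (op t f).
Proof.
move=> t0 gen; have [lf lg _] := gen.
have t20 : 0 <= t / 2 by rewrite divr_ge0// ltW.
have genv := generates_op t20 gen.
set v := op (t / 2) f in genv *; set w := op (t / 2) g in genv *.
have [lv lw _] := genv.
apply: (@ler_eps _ _ _ (t * nm v)); first by rewrite mulr_ge0 ?rnorm_ge0 ?ltW.
move=> e e0 _; have [r r0 H] := generates_slope genv e0.
have [n nr] := small_step t0 r0; set m := n.+1%:R in nr.
have m0 : 0 < m by rewrite ltr0n.
have h0 : 0 < t / m by rewrite divr_gt0.
have mt : m * (t / m) = t by rewrite mulrCA divff ?mulr1// gt_eqF.
have := H _ h0 nr; rewrite ler_norml => /andP[slope _].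
have tt : t / 2 + t / 2 = t by rewrite -splitr.
have vv : ip v v = ip f (op t f) by rewrite (ip_op t20 t20 lf) tt.
have vP : ip v (op (t / m) v) = ip f (op (t + t / m) f).
  have h0' := ltW h0.
  have -> : t + t / m = t / 2 + (t / 2 + t / m) by rewrite addrA tt.
  rewrite -(ip_op t20 (addr_ge0 t20 h0') lf).
  apply: (ae_eq_ip lv (op_L2 h0' lv) (op_L2 (addr_ge0 t20 h0') lf)).
  have := op_comp_ae SP h0' t20 (Lfun_int mu1 le12 lf).
  by apply: filterS => x; rewrite addrC => ->.
have [_] := ip_op_slopes n.+1 (ltW h0) lf; rewrite -/m mt.
rewrite -vv -vP => cvx.
have E : m * (ip v v - ip v (op (t / m) v)) =
    t * ((t / m)^-1 * (ip v v - ip v (op (t / m) v))).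
  by move: (ip v v - _) => z; field; rewrite !gt_eqF.
rewrite {}E in cvx; move: slope cvx.
move: (ip v w) (ip f f - ip v v) (nm v) (_^-1 * _) => a b c z slope cvx.
by have := ler_wpM2l (ltW t0) slope; clear -cvx; lra.
Qed.

End L2Semigroup.

Section PoincareDecay.
Context (R : realType) d (T : measurableType d) (mu : probability T R).
Context (P : R -> R.-pker T ~> T) (SP : symmetric_semigroup mu P).
Context (D : set (T -> R)) (L : (T -> R) -> T -> R).
Implicit Types (f g u v w : T -> R) (s t e : R).

Let mu1 : mu setT = 1%E := probability_setT mu.
Local Notation op t := (kernel_op (P t)).
Local Notation L2 := (Lfun mu 2%:E).
Local Notation nm := (rnorm mu 2).
Local Notation N := (cnorm mu 2).
Local Notation mean f := (\int[mu]_y f y).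
Local Notation ip f g := (\int[mu]_x (f x * g x)).

Let le12 : (1 : R) <= 2. Proof. by rewrite ler1n. Qed.

Hypothesis gen_core : forall f, D f -> generates mu P f (L f).
Hypothesis dense_core : forall f, f \in L2 -> forall e, 0 < e ->
  exists2 g, D g & nm (f \- g) < e.
Hypothesis graph_core : forall f g, generates mu P f g -> forall e, 0 < e ->
  exists h, [/\ D h, nm (f \- h) < e & nm (g \- L h) < e].

(* Linear arithmetic from the goal alone. *)
Local Ltac goal_lra := clear -SP gen_core dense_core graph_core mu1 le12; lra.

(** Decay in L^2 implies the Poincare inequality: the variance lost up to a time
    at which at least half of it has gone is bounded by that time times the energy. *)
Lemma L2_decay_poincare : Lp_decay mu P 2 ->
  exists C : R, forall f, D f -> N f ^+ 2 <= C * - ip f (L f).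
Proof.
move=> [l [K [l0 dec]]]; pose s := (2 * `|K| + 1) / l.
have s0 : 0 < s by rewrite divr_gt0// ltr_wpDl ?mulr_ge0.
exists (2 * (s + s)) => f Df; have gen := gen_core Df; have [lf _ _] := gen.
(* The choice of s makes expR (l * s) at least 2 |K|. *)
have half : K * expR (- l * s) <= 2^-1.
  have ls : l * s = 2 * `|K| + 1 by rewrite /s mulrC divfK// gt_eqF.
  rewrite mulNr expRN ler_pdivrMr ?expR_gt0// ls.
  have := expR_ge1Dx (2 * `|K| + 1); have := ler_norm K; lra.
have Nh : N (op s f) <= 2^-1 * N f.
  apply: le_trans (dec f lf s (ltW s0)) _.
  by rewrite ler_wpM2r ?rnorm_ge0.
have N0 : 0 <= N (op s f) by exact: rnorm_ge0.
have Nh2 : N (op s f) ^+ 2 <= 2^-1 * N f ^+ 2.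
  have : N (op s f) ^+ 2 <= (2^-1 * N f) ^+ 2 by rewrite ler_sqr ?nnegrE// (le_trans N0).
  have := sqr_ge0 (N f); rewrite exprMn.
  move: (N f ^+ 2) (N (op s f) ^+ 2) => x y x0.
  by move: x0; rewrite expr2; goal_lra.
have := dissipation_le SP (addr_gt0 s0 s0) gen.
have E1 := cnorm_sqr lf; have E2 := cnorm_sqr_op SP (ltW s0) lf.
move: Nh2; rewrite {}E1 {}E2.
move: (ip f f) (ip f (op _ f)) (mean f ^+ 2) (ip f (L f)) => a b c z.
by goal_lra.
Qed.

(** A Poincare inequality on the core extends to the domain of the generator,
    because both sides are continuous for the graph norm. *)
Lemma poincare_generator (C : R) v w : 0 <= C ->
  (forall f, D f -> N f ^+ 2 <= C * - ip f (L f)) ->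
  generates mu P v w -> N v ^+ 2 <= C * - ip v w.
Proof.
move=> C0 poinc gen; have [lv lw _] := gen.
have [nv0 nw0] := (rnorm_ge0 mu 2 v, rnorm_ge0 mu 2 w).
(* An element h of the core within e of v, with L h within e of w, changes
   both sides by a multiple of e. *)
apply: (@ler_eps _ _ _ (C * (nm w + nm v + 1) + 8 * (nm v + 1) + 4)).
  by rewrite !addr_ge0 ?mulr_ge0 ?addr_ge0.
move=> e e0 e1; have [h [Dh vh wh]] := graph_core gen e0.
have [lh lLh _] := gen_core Dh.
have nh : nm h <= nm v + e.
  by have := rnorm_sub le12 lh lv; rewrite rnormBC; move: vh; goal_lra.
have Nvh : N v <= N h + 2 * e.
  by have := cnorm_sub le12 lv lh; move: vh; goal_lra.
have Nh : N h <= 2 * (nm v + 1).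
  by have := cnorm_le le12 lh; move: nh e1; goal_lra.
have ipE : ip v w - ip h (L h) = ip (v \- h) w + ip h (w \- L h).
  rewrite (ipBl lv lh lw) (ipBr lw lLh lh).
  by move: (ip v w) (ip h w) (ip h (L h)) => a b c; ring.
have ip1 : ip (v \- h) w <= e * nm w.
  apply: le_trans (ler_norm _) _; apply: le_trans (ip_le (LfunB le12 lv lh) lw) _.
  by rewrite ler_wpM2r// ltW.
have ip2 : ip h (w \- L h) <= (nm v + 1) * e.
  apply: le_trans (ler_norm _) _; apply: le_trans (ip_le lh (LfunB le12 lw lLh)) _.
  apply: ler_pM; rewrite ?rnorm_ge0//; last exact: ltW.
  by apply: le_trans nh _; rewrite lerD2l.
have main := poinc h Dh.
have NvE : N v ^+ 2 <= N h ^+ 2 + (8 * (nm v + 1) + 4) * e.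
  have Nv0 : 0 <= N v by exact: rnorm_ge0.
  have Nh0 : 0 <= N h by exact: rnorm_ge0.
  apply: (@le_trans _ _ ((N h + 2 * e) ^+ 2)).
    by rewrite ler_sqr ?nnegrE//; exact: le_trans Nvh.
  have := ler_wpM2l (ltW e0) Nh; have := ler_wpM2l (ltW e0) e1.
  move: (N h) (nm v) => a b; rewrite !expr2.
  by clear -SP gen_core dense_core graph_core mu1 le12; nra.
have ipC' : C * (ip v w - ip h (L h)) <= C * ((nm w + nm v + 1) * e).
  rewrite ler_wpM2l// ipE.
  by move: ip1 ip2; move: (ip _ w) (ip h _) => a b; goal_lra.
move: NvE main ipC'.
move: (ip v w) (ip h (L h)) (N v ^+ 2) (N h ^+ 2) (nm v) (nm w) => a b x y p q.
goal_lra.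
Qed.

(** One half unit of time contracts the centred norm: by convexity the energy
    of P_(1/2) f is at most |f|^2 - <f, P_1 f>, which is Var f - Var P_(1/2) f. *)
Lemma poincare_contraction :
  (exists C : R, forall f, D f -> N f ^+ 2 <= C * - ip f (L f)) ->
  exists2 rho : R, 0 < rho < 1 &
    forall f, f \in L2 -> N (op 2^-1 f) <= rho * N f.
Proof.
move=> [C0 poinc0]; pose C := `|C0| + 1.
have C1 : 0 < C by rewrite ltr_wpDl.
have poinc f : D f -> N f ^+ 2 <= C * - ip f (L f).
  move=> Df; apply: le_trans (poinc0 f Df) _.
  apply: ler_wpM2r; first exact: dirichlet_form_ge0 (gen_core Df).
  by apply: le_trans (ler_norm C0) _; rewrite lerDl.
(* (1 + C) Var P_(1/2) f <= C Var f *)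
pose rho := Num.sqrt (C / (1 + C)).
have C11 : 0 < 1 + C := addr_gt0 ltr01 C1.
have q0 : 0 < C / (1 + C) := divr_gt0 C1 C11.
have rho0 : 0 < rho by rewrite sqrtr_gt0.
have half0 : 0 <= (2 : R)^-1 by rewrite invr_ge0.
have half1 : (2 : R)^-1 + 2^-1 = 1 by rewrite [RHS]splitr !div1r.
have coreN f : D f -> N (op 2^-1 f) <= rho * N f.
  move=> Df; have gen := gen_core Df; have [lf _ _] := gen.
  have := dissipation_ge SP ltr01 gen; rewrite mul1r div1r => diss.
  have := poincare_generator (ltW C1) poinc (generates_op SP half0 gen).
  set E := - ip _ _ in diss *; move=> pv.
  have sq : (1 + C) * N (op 2^-1 f) ^+ 2 <= C * N f ^+ 2.
    have E1 := cnorm_sqr lf; have E2 := cnorm_sqr_op SP half0 lf.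
    rewrite half1 in E2; move: diss E1 E2 pv.
    move: (N f ^+ 2) (N _ ^+ 2) (ip f f) (ip f _) (mean f ^+ 2) E => x y a b c z.
    move=> diss E1 E2 pv; have := ler_wpM2l (ltW C1) diss.
    by move: pv; rewrite {}E1 {}E2; goal_lra.
  have Nf0 : 0 <= N f by exact: rnorm_ge0.
  have NP0 : 0 <= N (op 2^-1 f) by exact: rnorm_ge0.
  have rN0 : 0 <= rho * N f by rewrite mulr_ge0// ltW.
  rewrite -ler_sqr ?nnegrE// exprMn (sqr_sqrtr (ltW q0)).
  by rewrite mulrAC ler_pdivlMr// mulrC.
exists rho.
  rewrite rho0/= -(sqrtr1 R) ltr_sqrt// ltr_pdivrMr//.
  by rewrite mul1r ltrDr.
move=> f lf; apply: (@ler_eps _ _ _ (2 * rho + 2)).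
  by rewrite addr_ge0 ?mulr_ge0// ltW.
move=> e e0 _; have [g Dg fg] := dense_core lf e0.
have [lg _ _] := gen_core Dg.
have h1 := cnorm_sub le12 (op_L2 SP half0 lf) (op_L2 SP half0 lg).
have h2 := rnorm_opB SP le12 half0 lf lg.
have h3 := coreN g Dg.
have h4 := cnorm_sub le12 lg lf; rewrite rnormBC in h4.
have h5 : rho * N g <= rho * (N f + 2 * e).
  by rewrite ler_wpM2l ?ltW//; move: h4 fg; goal_lra.
by move: h1 h2 h3 h5 fg; goal_lra.
Qed.

(** Iterating the contraction over the steps of length 1/2 gives the decay in
    L^2. *)
Lemma poincare_L2_decay :
  (exists C : R, forall f, D f -> N f ^+ 2 <= C * - ip f (L f)) ->
  Lp_decay mu P 2.
Proof.
move=> /poincare_contraction [rho /andP[rho0 rho1] step].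
have half0 : 0 <= (2 : R)^-1 by rewrite invr_ge0.
have iter n f : f \in L2 -> N (op (n%:R / 2) f) <= rho ^+ n * N f.
  move=> lf; have n0 k : 0 <= k%:R / 2 :> R by rewrite mulr_ge0.
  elim: n => [|n IH].
    by rewrite mul0r mul1r (op0 SP)//; exact: Lfun_measurable lf.
  have nE : n.+1%:R / 2 = 2^-1 + n%:R / 2 :> R by rewrite -natr1 mulrDl mul1r addrC.
  have lP := op_L2 SP (n0 n) lf.
  have -> : N (op (n.+1%:R / 2) f) = N (op 2^-1 (op (n%:R / 2) f)).
    apply: (ae_eq_cnorm le12 (op_L2 SP (n0 n.+1) lf) (op_L2 SP half0 lP)).
    by rewrite nE; exact: (op_comp_ae SP half0 (n0 n) (Lfun_int mu1 le12 lf)).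
  apply: le_trans (step _ lP) _.
  by rewrite exprS -mulrA ler_wpM2l// ltW.
have lnr : ln rho < 0 by rewrite ln_lt0// rho0.
(* The steps fit n = floor (2 t) > 2 t - 1 times in [0, t]. *)
exists (- 2 * ln rho), rho^-1; split; first by rewrite mulNr oppr_gt0 pmulr_rlt0.
move=> f lf t t0; pose n := Num.truncn (2 * t).
have /andP[nt tn] : n%:R <= 2 * t < n.+1%:R by apply: truncn_itv; rewrite mulr_ge0.
have r0 : 0 <= t - n%:R / 2.
  by rewrite subr_ge0 ler_pdivrMr// mulrC.
have n0 : 0 <= n%:R / 2 :> R by rewrite mulr_ge0.
have lP := op_L2 SP n0 lf.
have -> : N (op t f) = N (op (t - n%:R / 2) (op (n%:R / 2) f)).
  apply: (ae_eq_cnorm le12 (op_L2 SP t0 lf) (op_L2 SP r0 lP)).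
  have := op_comp_ae SP r0 n0 (Lfun_int mu1 le12 lf).
  by apply: filterS => x; rewrite subrK.
apply: le_trans (cnorm_op SP le12 r0 lP) _.
apply: le_trans (iter n f lf) _; rewrite ler_wpM2r ?rnorm_ge0//.
have -> : rho^-1 * expR (- (- 2 * ln rho) * t) = expR ((2 * t - 1) * ln rho).
  rewrite -{1}(lnK (x := rho)) ?posrE// -expRN -expRD; congr expR; ring.
rewrite -{1}(lnK (x := rho)) ?posrE// -expRM_natl ler_expR.
rewrite ler_nM2r//; move: tn; rewrite -natr1; goal_lra.
Qed.

End PoincareDecay.

(** * Symmetric diffusions *)

Section Diffusion.
Context (R : realType) (E : completePseudoMetricType R).
Context (d : measure_display) (Omega : measurableType d).
Context (F : R -> set (set Omega)) (X : R -> Omega -> borel E).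
Context (Q : E -> probability Omega R) (P : R -> R.-pker borel E ~> borel E).
Context (L : (borel E -> R) -> borel E -> R) (D : set (borel E -> R)).
Context (mu : probability (borel E) R).
Hypothesis H : symmetric_diffusion F X Q P L D mu.
Implicit Types (f g : borel E -> R).

(** Of the process, only its transition function matters: the Chapman-Kolmogorov
    equation and the symmetry and contraction properties of the semigroup. *)
Lemma diffusion_semigroup : symmetric_semigroup mu P.
Proof.
have [_ _ [P0 PD] _ _] := sd_markov H.
split.
- exact: P0.
- by move=> s t s0 t0 x B mB; exact: PD.
- exact: (sd_symmetric H).
- by move=> p p1 f lf t t0; apply: (sd_contraction H).
Qed.

Lemma L2_generator_generates f g : L2_generator P mu f g -> generates mu P f g.
Proof.
move=> [lf lg lim]; split => // e e0.
have near0 : nbhs (0 : R) (fun h => 0 < h -> `|rnorm mu 2 (fun x =>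
    h^-1 * (semigroup P h f x - f x) - g x)| < e).
  exact: cvgr0_norm_lt _ (fine_cvg lim) _ e0.
have /nbhs_ballP[r /= r0 Hr] := near0.
exists r => // h h0 hr; apply: le_lt_trans (ler_norm _) _.
apply: (Hr h) => //.
by rewrite /ball /= sub0r normrN gtr0_norm.
Qed.

Lemma generates_L2_generator f g : generates mu P f g -> L2_generator P mu f g.
Proof.
move=> [lf lg gen]; split => //.
have SP := diffusion_semigroup.
have le12 : (1 : R) <= 2 by rewrite ler1n.
apply/fine_cvgP; split.
  apply/nbhs_ballP; exists 1 => //= h _ h0.
  rewrite /Lp_norm -EFin_rnorm//; apply: LfunB => //; apply: (LfunZ _ le12).
  by apply: LfunB => //; exact: (op_Lfun SP le12 (ltW h0)).
apply/cvgrPdist_lt => e e0; have [r r0 Hr] := gen e e0.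
apply/nbhs_ballP; exists r => //= h hr h0.
rewrite sub0r normrN ger0_norm ?rnorm_ge0//; apply: Hr => //.
by move: hr; rewrite /ball /= sub0r normrN gtr0_norm.
Qed.

Lemma generates_core f : D f -> generates mu P f (L f).
Proof. by have [core _ _] := sd_core H => /core; exact: L2_generator_generates. Qed.

Lemma dense_core f : f \in Lfun mu 2%:E -> forall e : R, 0 < e ->
  exists2 g, D g & rnorm mu 2 (f \- g) < e.
Proof.
move=> lf e e0; have [_ dense _] := sd_core H.
have [g [Dg fg]] := dense f lf e e0; exists g => //.
have [lg _ _] := generates_core Dg.
by rewrite -lte_fin EFin_rnorm//; apply: LfunB => //; rewrite ler1n.
Qed.

Lemma centered_norm_cnorm p f : 1 <= p -> f \in Lfun mu p%:E ->
  centered_norm mu p f = (cnorm mu p f)%:E.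
Proof. by move=> p1 lf; rewrite EFin_rnorm//; exact: Lfun_center. Qed.

Lemma exponential_decayE p : 1 <= p ->
  exponential_decay P mu p <-> Lp_decay mu P p.
Proof.
move=> p1; have SP := diffusion_semigroup.
have le_E f t (c : R) : f \in Lfun mu p%:E -> 0 <= t ->
    (centered_norm mu p (semigroup P t f) <= c%:E * centered_norm mu p f)%E =
    (cnorm mu p (kernel_op (P t) f) <= c * cnorm mu p f).
  move=> lf t0; rewrite !centered_norm_cnorm//; first exact: (op_Lfun SP).
by split=> -[l [K [l0 dec]]]; exists l, K; split => // f lf t t0;
  have := dec f lf t t0; rewrite le_E.
Qed.

(** The Poincare inequality on the core, with the variance written as the squared
    centred norm and the energy as -<f, L f>. *)
Lemma poincareE : poincare mu D L <->
  exists C : R, forall f, D f ->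
    cnorm mu 2 f ^+ 2 <= C * - \int[mu]_x (f x * L f x).
Proof.
have varE f : D f -> variance_of mu f = cnorm mu 2 f ^+ 2.
  move=> /generates_core[lf _ _]; rewrite (cnorm_sqr lf) /variance_of.
  by congr (_ - _); apply: eq_Rintegral => x _; rewrite expr2.
by split=> -[C poinc]; exists C => f Df; have := poinc f Df;
  rewrite (sd_dirichlet_form H Df) varE.
Qed.

End Diffusion.

Theorem theorem1p1 (R : realType) (E : completePseudoMetricType R)
    (d : measure_display) (Omega : measurableType d)
    (F : R -> set (set Omega)) (X : R -> Omega -> borel E)
    (Q : E -> probability Omega R) (P : R -> R.-pker borel E ~> borel E)
    (L : (borel E -> R) -> borel E -> R) (D : set (borel E -> R))
    (mu : probability (borel E) R)
    (H : symmetric_diffusion F X Q P L D mu) :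
  (poincare mu D L <-> exists2 p : R, 1 < p & exponential_decay P mu p) /\
  ((exists2 p : R, 1 < p & exponential_decay P mu p) <->
   (forall p : R, 1 < p -> exponential_decay P mu p)).
Proof.
have SP := diffusion_semigroup H.
have lt12 : (1 : R) < 2 by rewrite ltr1n.
have graph f g : generates mu P f g -> forall e, 0 < e ->
    exists h, [/\ D h, rnorm mu 2 (f \- h) < e & rnorm mu 2 (g \- L h) < e].
  move=> gen e e0; have [_ _ graph] := sd_core H; have [lf lg _] := gen.
  have [h [Dh fh gh]] := graph f g (generates_L2_generator H gen) e e0.
  have [lh lLh _] := generates_core H Dh.
  exists h; split => //.
    by rewrite -lte_fin EFin_rnorm//; exact: LfunB (ltW lt12) lf lh.
  by rewrite -lte_fin EFin_rnorm//; exact: LfunB (ltW lt12) lg lLh.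
have transfer p q : 1 < p -> 1 < q ->
    exponential_decay P mu p -> exponential_decay P mu q.
  move=> p1 q1 /(exponential_decayE H (ltW p1)) decp.
  apply/(exponential_decayE H (ltW q1)); apply: (bounded_decay_Lp SP (ltW q1)).
  apply: (bounded_decay_all SP p1 q1); exact: (Lp_decay_bounded SP (ltW p1)).
split; split.
- move=> /(poincareE H) poinc; exists 2 => //.
  apply/(exponential_decayE H (ltW lt12)).
  exact: (poincare_L2_decay SP (generates_core H) (dense_core H) graph).
- move=> [p p1 /(transfer _ _ p1 lt12)/(exponential_decayE H (ltW lt12)) dec2].
  apply/(poincareE H); exact: (L2_decay_poincare SP (generates_core H) dec2).
- by move=> [p p1 decp] q q1; exact: transfer decp.
- by move=> dec; exists 2 => //; exact: dec.
Qed.
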